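(* There is an algorithm that, given a tree $T$ with $n$ vertices and a coloring $c$ of $T$, computes an $\omega_{uc}$--dominating $c$--set of $(T,c)$ with computational cost $\mathcal{O}(n^2\log n)$ and memory cost $\mathcal{O}(n^2)$.
   Context: A coloring of a graph $G=(V,E)$ is a map $c:V\to\{0,1,2,\dots\}$ with $c(u)\neq c(v)$ whenever $u,v$ are adjacent. Given $(G,c)$, a set $D\subseteq V$ is an up--color dominating $c$--set if (1) every vertex $v\notin D$ has a neighbor $d\in D$ with $c(v)<c(d)$, and (2) $D$ contains no vertex of color $0$. The weight of $D$ is $\sum_{v\in D}c(v)$. An $\omega_{uc}$--dominating $c$--set is an up--color dominating $c$--set of minimum weight. *)

(* Defs.v *)
From mathcomp Require Import all_boot.

Set Implicit Arguments.
Unset Strict Implicit.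
Unset Printing Implicit Defensive.

(** * Graphs, colorings and up-color domination *)

(* [ucycle e p]: p is a closed e-walk without repeated vertices.  For a simple
   graph, [:: x; y] is one for every edge xy, and it is not a cycle of the
   graph; hence the bound 2. *)
Definition is_tree (V : finType) (e : rel V) : Prop :=
  [/\ 0 < #|V|, symmetric e, irreflexive e,
      (forall x y : V, connect e x y) &
      (forall p : seq V, ucycle e p -> size p <= 2)].

Definition is_coloring (V : finType) (e : rel V) (c : V -> nat) : Prop :=
  forall u v : V, e u v -> c u != c v.

Definition up_color_dominating (V : finType) (e : rel V) (c : V -> nat)
    (D : {set V}) : Prop :=
  (forall v, v \notin D -> exists2 d, d \in D & e v d && (c v < c d)) /\
  (forall v, v \in D -> c v != 0).

Definition weight (V : finType) (c : V -> nat) (D : {set V}) : nat :=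
  \sum_(v in D) c v.

Definition omega_uc_dominating (V : finType) (e : rel V) (c : V -> nat)
    (D : {set V}) : Prop :=
  up_color_dominating e c D /\
  (forall D' : {set V}, up_color_dominating e c D' -> weight c D <= weight c D').

(** * Computational model

   A word RAM, programmed in a structured language.  A machine with parameters
   [S] and [W] has [S] memory cells, with addresses 0, ..., S - 1, and
   registers; cells and registers hold words, that is, natural numbers smaller
   than [W].  An execution that touches an address >= S or produces a number
   >= W gets stuck.  A program names its registers explicitly, so it uses a
   constant number of them; memory is therefore measured by [S] alone. *)

Inductive binop := Add | Sub | Mul | Lt | Eq.

Inductive expr :=
| Const of nat
| Reg of nat
| Read of expr
| Op of binop & expr & expr.

Inductive com :=
| Skip
| Set_reg of nat & expr
| Write of expr & expr
| Seq of com & com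
| If of expr & com & com
| While of expr & com.

Record state := State { regs : nat -> nat; mem : nat -> nat }.

Definition set_reg (s : state) (x v : nat) : state :=
  State [eta regs s with x |-> v] (mem s).

Definition set_mem (s : state) (a v : nat) : state :=
  State (regs s) [eta mem s with a |-> v].

(* [Sub] is truncated subtraction; the tests [Lt] and [Eq] return 0 or 1. *)
Definition apply_op (o : binop) (m n : nat) : nat :=
  match o with
  | Add => m + n
  | Sub => m - n
  | Mul => m * n
  | Lt => m < n
  | Eq => m == n
  end.

Definition word (W v : nat) : option nat := if v < W then Some v else None.

Fixpoint eval (S W : nat) (s : state) (a : expr) : option nat :=
  match a with
  | Const k => word W k
  | Reg x => word W (regs s x)
  | Read a1 =>
      if eval S W s a1 is Some i then
        if i < S then word W (mem s i) else None
      else None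
  | Op o a1 a2 =>
      if eval S W s a1 is Some m then
        if eval S W s a2 is Some n then word W (apply_op o m n) else None
      else None
  end.

(* Number of elementary operations performed to evaluate an expression. *)
Fixpoint expr_cost (a : expr) : nat :=
  match a with
  | Const _ | Reg _ => 1
  | Read a1 => (expr_cost a1).+1
  | Op _ a1 a2 => (expr_cost a1 + expr_cost a2).+1
  end.

(* [exec S W p s t s']: on the machine with parameters S and W, program p
   started in state s halts after t elementary steps in state s'. *)
Inductive exec (S W : nat) : com -> state -> nat -> state -> Prop :=
| ExecSkip s :
    exec S W Skip s 1 s
| ExecSet x a s v :
    eval S W s a = Some v ->
    exec S W (Set_reg x a) s (expr_cost a).+1 (set_reg s x v)
| ExecWrite a1 a2 s i v :
    eval S W s a1 = Some i -> i < S -> eval S W s a2 = Some v ->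
    exec S W (Write a1 a2) s (expr_cost a1 + expr_cost a2).+1 (set_mem s i v)
| ExecSeq p q s s1 s2 t1 t2 :
    exec S W p s t1 s1 -> exec S W q s1 t2 s2 ->
    exec S W (Seq p q) s (t1 + t2) s2
| ExecIf a p q s s' v t :
    eval S W s a = Some v -> exec S W (if v != 0 then p else q) s t s' ->
    exec S W (If a p q) s (expr_cost a + t).+1 s'
| ExecWhileStop a p s :
    eval S W s a = Some 0 ->
    exec S W (While a p) s (expr_cost a).+1 s
| ExecWhileStep a p s s1 s2 v t1 t2 :
    eval S W s a = Some v -> v != 0 ->
    exec S W p s t1 s1 -> exec S W (While a p) s1 t2 s2 ->
    exec S W (While a p) s (expr_cost a + t1 + t2).+1 s2.

(** * Input and output of a program on a colored graph *)

(* Register 0 holds n; the cells 0, ..., n - 1 hold the colors and the next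
   n ^ 2 cells the adjacency matrix, row by row; everything else is 0. *)
Definition input (n : nat) (e : rel 'I_n) (c : 'I_n -> nat) : state :=
  State
    (fun x => if x == 0 then n else 0)
    (nth 0 ([seq c v | v <- enum 'I_n] ++
            [seq nat_of_bool (e u v) | u <- enum 'I_n, v <- enum 'I_n])).

(* The first n cells hold the characteristic vector of the result. *)
Definition output (n : nat) (s : state) : {set 'I_n} :=
  [set v : 'I_n | mem s v != 0].

(* Words of O(log (n + max c)) bits. *)
Definition word_bound (k n : nat) (c : 'I_n -> nat) : nat :=
  (n + (\max_(v < n) c v) + 2) ^ k.

(* Main.v *)
(* Root the tree and list its vertices in breadth-first order, so that every
   vertex but the first has exactly one neighbour among its predecessors. A set D
   is scored by its weight, plus a penalty M = 1 + (sum of all colors) for every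
   vertex of color 0 in D and for every undominated vertex outside D: since sets
   without defects cost less than M, the cheapest sets are the minimum weight
   up-color dominating sets, and all costs are finite. The score of D is a sum
   over the vertices of a cost depending on the status of the vertex: in D,
   dominated, or undominated. The last vertex of the order only interacts with its
   parent, so minimizing over its membership amounts to updating the three costs
   of the parent. Eliminating the vertices backwards while recording the optimal
   choices, then replaying the choices forwards, yields an optimal D. With an
   adjacency matrix all of this takes O(n^2) steps. *)
Require Import Defs.
From mathcomp Require Import all_boot zify.

Set Implicit Arguments.
Unset Strict Implicit.
Unset Printing Implicit Defensive.

(** * Dynamic programming over an elimination order *)

Section DynamicProgramming.

(* Vertices are the positions [0, 1, 2, ...] of a search order, [q j < j] is the
   parent of position [j > 0], and [col] is the coloring. *)
Variables (q col : nat -> nat).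

(** The guards discard [q 0]: the root has no parent. *)
Definition adjp (j k : nat) : bool :=
  ((0 < j) && (q j == k)) || ((0 < k) && (q k == j)).

(** Only dominators among the first [m] positions count, so statuses refer to the subtree that these
    positions induce. *)
Definition dominated (m : nat) (x : nat -> bool) (j : nat) : bool :=
  has (fun k => [&& adjp j k, x k & col j < col k]) (iota 0 m).

(* 0: not in the set and undominated; 1: not in the set, dominated; 2: in it. *)
Definition status (m : nat) (x : nat -> bool) (j : nat) : nat :=
  if x j then 2 else dominated m x j.

Definition total (K : nat -> nat -> nat) (m : nat) (x : nat -> bool) : nat :=
  \sum_(j < m) K (status m x j) j.

(** Joint cost of the last position [u] and its parent when [u] joins the set; [s] is the status of
    the parent in the absence of [u], and [u] can only lift it from 0 to 1. *)
Definition cost_in (K : nat -> nat -> nat) (s u : nat) : nat :=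
  K 2 u + K (s + (s == 0) * (col (q u) < col u)) (q u).

(** Left outside the set, [u] can only be dominated by its parent, which requires [s = 2]. *)
Definition cost_out (K : nat -> nat -> nat) (s u : nat) : nat :=
  K ((s == 2) * (col u < col (q u))) u + K s (q u).

Definition choose_in (K : nat -> nat -> nat) (s u : nat) : bool :=
  cost_in K s u < cost_out K s u.

Definition eliminate (K : nat -> nat -> nat) (u : nat) : nat -> nat -> nat :=
  fun s j => if j == q u then minn (cost_in K s u) (cost_out K s u) else K s j.

Lemma eq_dominated m x y j :
  (forall k, k < m -> x k = y k) -> dominated m x j = dominated m y j.
Proof.
move=> exy; apply: eq_in_has => k; rewrite mem_iota add0n => /andP[_ km].
by rewrite exy.
Qed.

Lemma eq_status m x y j :
  (forall k, k < m -> x k = y k) -> j < m -> status m x j = status m y j.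
Proof. by move=> exy jm; rewrite /status exy // (eq_dominated _ exy). Qed.

Lemma status_lt3 m x j : status m x j < 3.
Proof. by rewrite /status; case: (x j) => //; case: dominated. Qed.

Variable N : nat.
Hypothesis q_lt : forall j, 0 < j < N -> q j < j.

Lemma dominatedS m x j : j < m -> m < N ->
  dominated m.+1 x j = dominated m x j || [&& q m == j, x m & col j < col m].
Proof.
move=> jm mN; rewrite /dominated -[m.+1]addn1 iotaD has_cat /= orbF add0n /adjp.
have -> : (0 < j) && (q j == m) = false by have := q_lt (j := j); lia.
by rewrite /=; have -> : 0 < m by lia.
Qed.

Lemma dominated_last m x : 0 < m < N ->
  dominated m.+1 x m = x (q m) && (col m < col (q m)).
Proof.
move=> mN; have qm := q_lt mN; apply/hasP/idP => [[k]|H].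
  rewrite mem_iota /adjp => kr /and3P[adj xk ck].
  have -> : q m = k by have := q_lt (j := k); lia.
  by rewrite xk.
exists (q m); first by rewrite mem_iota; lia.
by rewrite H /adjp eqxx; case/andP: mN => ->.
Qed.

Lemma statusS_neq m x j : j < m -> m < N -> j != q m ->
  status m.+1 x j = status m x j.
Proof.
by move=> jm mN jq; rewrite /status dominatedS // eq_sym (negbTE jq) orbF.
Qed.

Lemma statusS_parent m x : 0 < m < N ->
  status m.+1 x (q m) =
  status m x (q m) + [&& x m, status m x (q m) == 0 & col (q m) < col m].
Proof.
move=> mN; have qm := q_lt mN; rewrite /status.
case: (x (q m)); first by rewrite andbF.
rewrite dominatedS ?eqxx //=; last by case/andP: mN.
by case: dominated => /=; rewrite ?andbF //; case: (x m).
Qed.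

Lemma status_last m x : 0 < m < N ->
  status m.+1 x m =
  if x m then 2 else (status m x (q m) == 2) * (col m < col (q m)).
Proof.
move=> mN; rewrite /status; case: (x m) => //.
rewrite dominated_last //; case: (x (q m)) => /=; first by rewrite mul1n.
by case: dominated.
Qed.

(** Position [m] is a leaf of the subtree on the first [m.+1] positions: adding it affects no status
    but its own and that of its parent. *)
Lemma total_split K m x : 0 < m < N ->
  total K m.+1 x =
  \sum_(j < m | j != q m :> nat) K (status m x j) j +
  (if x m then cost_in else cost_out) K (status m x (q m)) m.
Proof.
move=> mN; have qm := q_lt mN; rewrite /total big_ord_recr /=.
rewrite (bigD1 (Ordinal qm)) //= addnAC addnC; congr (_ + _).
  apply: eq_bigr => j jq; rewrite statusS_neq //; by case/andP: mN.
rewrite statusS_parent // status_last //; case: (x m) => /=.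
  by rewrite /cost_in addnC mulnb.
by rewrite addn0 addnC /cost_out.
Qed.

Lemma total_elim K m x : 0 < m < N ->
  total (eliminate K m) m x =
  \sum_(j < m | j != q m :> nat) K (status m x j) j +
  minn (cost_in K (status m x (q m)) m) (cost_out K (status m x (q m)) m).
Proof.
move=> mN; have qm := q_lt mN; rewrite /total.
rewrite (bigD1 (Ordinal qm)) //= {1}/eliminate eqxx addnC; congr (_ + _).
by apply: eq_bigr => j jq; rewrite /eliminate (negbTE (jq : j != q m :> nat)).
Qed.

Lemma total_elim_le K m x : 0 < m < N ->
  total (eliminate K m) m x <= total K m.+1 x.
Proof.
move=> mN; rewrite total_elim // total_split // leq_add2l.
by case: (x m); [apply: geq_minl | apply: geq_minr].
Qed.

Lemma total_elim_choice K m x : 0 < m < N ->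
  x m = choose_in K (status m x (q m)) m ->
  total (eliminate K m) m x = total K m.+1 x.
Proof.
(* [choose_in] and [minn] use the same strict comparison, so they agree on ties. *)
move=> mN xm; rewrite total_elim // total_split // xm /choose_in /minn.
by case: ifP.
Qed.

Definition optimal (K : nat -> nat -> nat) (m : nat) (x : nat -> bool) : Prop :=
  forall y, total K m x <= total K m y.

(** The eliminated total is a lower bound for every extension, and the recorded choice attains
    it. *)
Lemma optimal_elim K m x : 0 < m < N ->
  x m = choose_in K (status m x (q m)) m ->
  optimal (eliminate K m) m x -> optimal K m.+1 x.
Proof.
move=> mN xm opt y; rewrite -total_elim_choice //.
exact: leq_trans (opt y) (total_elim_le _ _ mN).
Qed.

Lemma optimal1 K x : x 0 = (K 2 0 < K 0 0) -> optimal K 1 x.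
Proof.
have E y : total K 1 y = if y 0 then K 2 0 else K 0 0.
  by rewrite /total big_ord1 /status /dominated /= /adjp /=; case: (y 0).
by move=> x0 y; rewrite !E x0; case: ifP; case: (y 0) => //; lia.
Qed.

(* The costs after eliminating the last [d] of [N] positions. *)
Fixpoint stage (K : nat -> nat -> nat) (d : nat) : nat -> nat -> nat :=
  if d is d'.+1 then eliminate (stage K d') (N - d) else K.

Lemma greedy_optimal K x : 0 < N ->
  x 0 = (stage K N.-1 2 0 < stage K N.-1 0 0) ->
  (forall j, 0 < j < N ->
     x j = choose_in (stage K (N - j.+1)) (status j x (q j)) j) ->
  optimal K N x.
Proof.
move=> N0 x0 xS.
(* Each prefix is optimal for the table in which all later positions have been eliminated; [m = N]
   is the claim. *)
suff H m : 0 < m <= N -> optimal (stage K (N - m)) m x.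
  by have := H N; rewrite subnn; apply; rewrite N0 leqnn.
elim: m => // m IH mN; have [->|m0] := posnP m.
  by apply: optimal1; rewrite subn1.
have mr : 0 < m < N by rewrite m0; lia.
apply: optimal_elim => //; first exact: xS.
have := IH; rewrite -[N - m]prednK ?subn_gt0; last by lia.
rewrite -subnS /= (_ : N - (N - m.+1).+1 = m); last by lia.
by apply; lia.
Qed.

(** * Bounds on the intermediate costs *)

Definition max3 (K : nat -> nat -> nat) (j : nat) : nat :=
  maxn (K 0 j) (maxn (K 1 j) (K 2 j)).

Lemma leq_max3 K s j : s < 3 -> K s j <= max3 K j.
Proof. by rewrite /max3; case: s => [|[|[|]]] // _; lia. Qed.

Lemma cost_in_le K s u : s < 3 -> cost_in K s u <= max3 K u + max3 K (q u).
Proof.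
move=> s3; apply: leq_add; apply: leq_max3 => //.
by case: s s3 => [|[|[|]]] // _; case: (_ < col u).
Qed.

Lemma max3_elim_parent K u : max3 (eliminate K u) (q u) <= max3 K u + max3 K (q u).
Proof.
rewrite {1}/max3 /eliminate eqxx !geq_max.
by rewrite !(leq_trans (geq_minl _ _)) // cost_in_le.
Qed.

(** The sum of the row maxima is a potential: an elimination merges the row of the last position
    into that of its parent without increasing it. Intermediate costs thus stay below the initial
    sum, which excludes overflow of machine words. *)
Lemma sum_max3_stage K d : d < N ->
  \sum_(j < N - d) max3 (stage K d) j <= \sum_(j < N) max3 K j.
Proof.
elim: d => [|d IH] dN; first by rewrite subn0.
apply: leq_trans (IH (ltnW dN)); set K' := stage K d.
have [m Em] : exists m, N - d = m.+1 by exists (N - d).-1; lia.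
have Em' : N - d.+1 = m by lia.
rewrite /= -/K' Em Em' big_ord_recr /=; have qm : q m < m by apply: q_lt; lia.
rewrite (bigD1 (Ordinal qm)) //= [in X in _ <= X](bigD1 (Ordinal qm)) //=.
rewrite addnAC leq_add //; first by rewrite addnC max3_elim_parent.
by apply: leq_sum => j jq; rewrite /max3 /eliminate (negbTE (jq : j != q m :> nat)).
Qed.

(** Both [cost_in] and [cost_out] add one entry of each of two distinct rows, so this bounds every
    sum formed during an elimination. *)
Lemma stage_pair_le K d i j s s' : d < N -> i < N - d -> j < N - d -> i != j ->
  s < 3 -> s' < 3 ->
  stage K d s i + stage K d s' j <= \sum_(j < N) max3 K j.
Proof.
move=> dN id jd ij s3 s'3; apply: leq_trans (sum_max3_stage K dN).
rewrite (bigD1 (Ordinal id)) //= (bigD1 (Ordinal jd)) /=; last first.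
  by rewrite -val_eqE /= eq_sym.
by rewrite addnA (leq_trans _ (leq_addr _ _)) // leq_add // leq_max3.
Qed.

End DynamicProgramming.

(** * Search orders of trees *)

Section Tree.

Variables (V : finType) (e : rel V).
Hypothesis tree : is_tree e.

Let e_sym : symmetric e. Proof. by case: tree. Qed.

(** If [a] and [b] differed, a simple path joining them inside [X] would close up through [v] to a
    cycle of length at least 3. *)
Lemma tree_inj_neighbour (X : {pred V}) (v a b : V) :
  (forall x y, x \in X -> y \in X ->
     connect [rel u w | [&& e u w, u \in X & w \in X]] x y) ->
  v \notin X -> a \in X -> b \in X -> e v a -> e v b -> a = b.
Proof.
move=> conn vX aX bX va vb.
have /connectP[p0 p0P ep0] := conn a b aX bX.
move: bX vb; rewrite ep0; case/shortenP: p0P => p pP pU _ bX vb.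
have pX : all [in X] p.
  elim: p a pP {pU aX va bX vb ep0} => //= y p IH a /andP[/and3P[_ _ yX] yp].
  by rewrite yX (IH y).
case: p pP pU bX vb pX => [//|y p] pP pU bX vb pX.
have : ucycle e [:: v, a, y & p].
  apply/andP; split; last first.
    rewrite cons_uniq pU andbT inE negb_or; apply/andP; split.
      by apply: contraNneq vX => ->.
    by apply/negP => /(allP pX) /=; apply/negP.
  have := rcons_path e v [:: a, y & p] v => /= ->; rewrite va /=.
  apply/andP; split; last by rewrite e_sym.
  by apply: (sub_path _ pP) => u w /and3P[].
by case: tree => _ _ _ _ acyc /acyc.
Qed.

Lemma tree_closed (X : {pred V}) (a : V) :
  a \in X -> (forall u w, u \in X -> e u w -> w \in X) -> forall v, v \in X.
Proof.
move=> aX clX v; case: tree => _ _ _ /(_ a v) /connectP[p pP ->] _.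
elim: p a aX pP => //= y p IH a aX /andP[ay yp].
exact: IH (clX _ _ aX ay) yp.
Qed.

(* [ord] lists [m] distinct vertices, each but the first one after its parent,
   which is its only neighbour among the vertices listed before it. *)
Record search_order (ord : nat -> V) (q : nat -> nat) (m : nat) : Prop :=
  SearchOrder {
    ord_inj : forall j k, j < m -> k < m -> ord j = ord k -> j = k;
    parent_lt : forall j, 0 < j < m -> q j < j;
    parent_edge : forall j, 0 < j < m -> e (ord j) (ord (q j));
    parent_uniq : forall j k, j < k < m -> e (ord k) (ord j) -> q k = j }.

(** The earlier of two adjacent positions is the parent of the later one, so the parent function
    recovers the whole edge relation. *)
Lemma search_order_edge ord q m j k : search_order ord q m ->
  j < m -> k < m -> e (ord j) (ord k) = adjp q j k.
Proof.
move=> so jm km; rewrite /adjp.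
have e_irr : irreflexive e by case: tree.
have parentE a b : a < b -> b < m -> e (ord b) (ord a) = (q b == a).
  move=> ab bm; apply/idP/eqP => [|<-]; first by apply: (parent_uniq so); lia.
  by apply: (parent_edge so); lia.
case: (ltngtP j k) => [jk|kj|->]; last first.
- rewrite e_irr; case: k {km jm} (km) => //= k km.
  by have := parent_lt so (j := k.+1); lia.
- rewrite parentE //; have -> : 0 < j by lia.
  by have := parent_lt so (j := k); lia.
- rewrite e_sym parentE //; have -> : 0 < k by lia.
  by have := parent_lt so (j := j); lia.
Qed.

(** Following parents from any listed vertex leads to the root without leaving the list. *)
Lemma search_order_connect ord q m : search_order ord q m ->
  let X := [pred v | v \in [seq ord j | j <- iota 0 m]] in
  forall x y, x \in X -> y \in X ->
  connect [rel u w | [&& e u w, u \in X & w \in X]] x y.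
Proof.
move=> so X; set eX := [rel u w | _].
have eX_sym : connect_sym eX.
  by apply: sym_connect_sym => u w; rewrite /= e_sym [(w \in X) && _]andbC.
have ordX j : j < m -> ord j \in X.
  by move=> jm; apply: (map_f ord); rewrite mem_iota.
have root j : j < m -> connect eX (ord j) (ord 0).
  elim/ltn_ind: j => j IH jm; case: (posnP j) => [->|j0]; first exact: connect0.
  have jr : 0 < j < m by rewrite j0.
  have qj := parent_lt so jr; have qm := ltn_trans qj jm.
  apply: connect_trans (IH _ qj qm); apply: connect1.
  by rewrite /= (parent_edge so) // !ordX.
move=> x y /mapP[j]; rewrite mem_iota => /andP[_ jm] -> /mapP[k].
rewrite mem_iota => /andP[_ km] ->; apply: connect_trans (root _ jm) _.
by rewrite eX_sym root.
Qed.

Lemma search_order_ext ord q ord' q' m : search_order ord q m ->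
  (forall j, j < m -> ord' j = ord j) -> (forall j, j < m -> q' j = q j) ->
  search_order ord' q' m.
Proof.
move=> so eo eq; split.
- by move=> j k jm km; rewrite !eo //; apply: (ord_inj so).
- by move=> j jr; rewrite eq ?(parent_lt so) //; case/andP: jr.
- move=> j jr; have := parent_lt so jr => qj.
  by rewrite eq ?eo ?(parent_edge so) //; lia.
- by move=> j k jk; rewrite !eo ?eq; try lia; apply: (parent_uniq so).
Qed.

(** The listed vertices form a connected set, so by [tree_inj_neighbour] the new vertex has no
    listed neighbour besides [ord i]. *)
Lemma search_orderS ord q m i : search_order ord q m -> i < m ->
  q m = i -> e (ord i) (ord m) -> (forall j, j < m -> ord j != ord m) ->
  search_order ord q m.+1.
Proof.
move=> so im qm eim new.
have ltm j : j < m.+1 -> j < m \/ j = m by lia.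
split.
- move=> j k /ltm[jm|->] /ltm[km|->] //; first exact: (ord_inj so).
  + by move=> E; move: (new _ jm); rewrite E eqxx.
  + by move=> E; move: (new _ km); rewrite E eqxx.
- move=> j /andP[j0 /ltm[jm|->]]; last by rewrite qm.
  by apply: (parent_lt so); rewrite j0.
- move=> j /andP[j0 /ltm[jm|->]]; last by rewrite qm e_sym.
  by apply: (parent_edge so); rewrite j0.
- move=> j k /andP[jk /ltm[km|Ek]] ekj; first by apply: (parent_uniq so); rewrite ?jk.
  rewrite {}Ek in jk ekj *; rewrite qm.
  have ordX l : l < m -> ord l \in [pred v | v \in [seq ord j | j <- iota 0 m]].
    by move=> lm; apply: map_f; rewrite mem_iota.
  apply: (ord_inj so) => //.
  apply: tree_inj_neighbour (search_order_connect so) _ (ordX _ im) (ordX _ jk) _ ekj.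
    apply/mapP => -[l]; rewrite mem_iota => /andP[_ lm] /eqP.
    by rewrite eq_sym (negbTE (new _ lm)).
  by rewrite e_sym.
Qed.

Lemma search_order_size ord q m : search_order ord q m -> m <= #|V|.
Proof.
move=> so; rewrite -(size_iota 0 m) -(size_map ord) -(card_uniqP _).
  exact: max_card.
rewrite map_inj_in_uniq ?iota_uniq // => j k; rewrite !mem_iota !add0n.
exact: (ord_inj so).
Qed.

(** A nonempty list closed under neighbours exhausts a connected graph. *)
Lemma search_order_full ord q m : search_order ord q m -> 0 < m ->
  (forall j, j < m -> forall w, e (ord j) w -> exists2 k, k < m & w = ord k) ->
  m = #|V|.
Proof.
move=> so m0 cl; apply/eqP; rewrite eqn_leq (search_order_size so) /=.
rewrite -[X in _ <= X](size_iota 0 m) -(size_map ord).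
rewrite (leq_trans _ (card_size _)) // subset_leq_card //.
apply/subsetP => v _; apply: (@tree_closed [in map ord (iota 0 m)] (ord 0)).
  by apply: map_f; rewrite mem_iota.
move=> u w /mapP[j]; rewrite mem_iota => /andP[_ jm] -> /(cl j jm)[k km ->].
by apply: map_f; rewrite mem_iota.
Qed.

(** * Penalized costs *)

Variable c : V -> nat.

Definition penalty : nat := (\sum_v c v).+1.

Definition initial_cost (ord : nat -> V) (s j : nat) : nat :=
  if s == 0 then penalty
  else if s == 1 then 0
  else c (ord j) + (c (ord j) == 0) * penalty.

Lemma max3_initial_cost ord j : max3 (initial_cost ord) j <= penalty.
Proof.
rewrite /max3 /initial_cost !geq_max /= leqnn /=.
case: eqP => [->|_]; first by rewrite mul1n.
by rewrite addn0 /penalty (bigD1 (ord j)) //= leqW ?leq_addr.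
Qed.

Variables (ord : nat -> V) (q : nat -> nat) (n : nat).
Hypotheses (so : search_order ord q n) (card_V : #|V| = n).

Let h (j : 'I_n) : V := ord j.

Let h_bij : bijective h.
Proof.
apply: inj_card_bij; last by rewrite card_V card_ord.
by move=> j k /(ord_inj so) E; apply: val_inj; apply: E.
Qed.

Lemma ord_onto v : exists2 j, j < n & v = ord j.
Proof. by have [g _ gK] := h_bij; exists (g v); rewrite // -[LHS]gK. Qed.

Variables (x : nat -> bool) (D : {set V}).
Hypothesis xD : forall j, j < n -> (ord j \in D) = x j.

Let col (j : nat) : nat := c (ord j).

Lemma dominatedP v j : j < n -> v = ord j ->
  reflect (exists2 d, d \in D & e v d && (c v < c d)) (dominated q col n x j).
Proof.
move=> jn ->; apply: (iffP hasP) => [[k]|[d]].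
  rewrite mem_iota add0n => /andP[_ kn] /and3P[jk xk ck].
  by exists (ord k); rewrite ?xD // (search_order_edge so) // jk.
have [k kn ->] := ord_onto d; rewrite xD // (search_order_edge so) // => xk /andP[jk ck].
by exists k; rewrite ?mem_iota // jk xk.
Qed.

Lemma weight_ord : weight c D = \sum_(j < n) x j * col j.
Proof.
have on_bij : {on predT, bijective h} by apply: onW_bij.
rewrite /weight big_mkcond (reindex h) //=; apply: eq_bigr => j _.
by rewrite xD //; case: (x j); rewrite ?mul1n.
Qed.

Lemma total_initial_cost : up_color_dominating e c D ->
  total q col (initial_cost ord) n x = weight c D.
Proof.
move=> [domD nzD]; rewrite weight_ord; apply: eq_bigr => j _.
rewrite /status -xD //; have [jD|jD] := boolP (ord j \in D).
  by rewrite /initial_cost /= (negbTE (nzD _ jD)) addn0 mul1n.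
by have /(dominatedP (ltn_ord j) erefl) -> := domD _ jD.
Qed.

(** A single defect already costs [penalty]. *)
Lemma up_color_dominating_total :
  total q col (initial_cost ord) n x < penalty -> up_color_dominating e c D.
Proof.
move=> lt_pen.
have lt_cost j : j < n -> initial_cost ord (status q col n x j) j < penalty.
  move=> jn; apply: leq_ltn_trans lt_pen.
  by rewrite /total (bigD1 (Ordinal jn)) //= leq_addr.
split=> v; have [j jn ->] := ord_onto v => jD.
  apply/(dominatedP jn erefl); have := lt_cost j jn.
  by rewrite /status -xD // (negbTE jD); case: dominated; rewrite ?ltnn.
have := lt_cost j jn; rewrite /status -xD // jD /initial_cost /=.
by apply: contraTneq => ->; rewrite mul1n -leqNgt.
Qed.

End Tree.

(** The weight of the given dominating set is below the penalty, hence so is the optimal total, and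
    the optimum is free of defects. Existence is assumed because a single vertex of color 0 admits
    no up-color dominating set. *)
Lemma optimal_omega_uc_dominating (V : finType) (e : rel V) (c : V -> nat)
    (ord : nat -> V) (q : nat -> nat) (n : nat) (x : nat -> bool) (D : {set V}) :
  is_tree e -> search_order e ord q n -> #|V| = n ->
  (forall j, j < n -> (ord j \in D) = x j) ->
  optimal q (fun j => c (ord j)) (initial_cost c ord) n x ->
  (exists D', up_color_dominating e c D') -> omega_uc_dominating e c D.
Proof.
move=> tree so cV xD opt [D0 D0P].
have le_total D' : up_color_dominating e c D' ->
    total q (fun j => c (ord j)) (initial_cost c ord) n x <= weight c D'.
  move=> D'P; apply: leq_trans (opt (fun j => ord j \in D')) _.
  by rewrite (@total_initial_cost _ _ tree c ord q n so cV _ D').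
have DP : up_color_dominating e c D.
  apply: (up_color_dominating_total tree so cV xD).
  rewrite ltnS (leq_trans (le_total _ D0P)) //.
  by rewrite /weight big_mkcond /=; apply: leq_sum => v _; case: ifP.
split=> // D' /le_total.
by rewrite (total_initial_cost tree so cV xD DP).
Qed.

(** * Reasoning about programs *)

(* A bound on the running time of [p] when no loop makes more than [N]
   iterations. *)
Fixpoint cost_bound (N : nat) (p : com) : nat :=
  match p with
  | Skip => 1
  | Set_reg _ a => (expr_cost a).+1
  | Write a1 a2 => (expr_cost a1 + expr_cost a2).+1
  | Seq p1 p2 => cost_bound N p1 + cost_bound N p2
  | If a p1 p2 => (expr_cost a + maxn (cost_bound N p1) (cost_bound N p2)).+1
  | While a p1 => N * (expr_cost a + cost_bound N p1).+1 + (expr_cost a).+1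
  end.

Fixpoint loop_depth (p : com) : nat :=
  match p with
  | Seq p1 p2 | If _ p1 p2 => maxn (loop_depth p1) (loop_depth p2)
  | While _ p1 => (loop_depth p1).+1
  | _ => 0
  end.

(** Each level of nesting contributes one factor [N]; the coefficient is the bound for loops of one
    iteration. *)
Lemma cost_bound_poly N p : 0 < N ->
  cost_bound N p <= cost_bound 1 p * N ^ loop_depth p.
Proof.
move=> N0.
have up a b d d' : d <= d' -> b <= a * N ^ d -> b <= a * N ^ d'.
  by move=> dd /leq_trans; apply; rewrite leq_mul2l leq_pexp2l ?orbT.
have pos d : 0 < N ^ d by rewrite expn_gt0 N0.
elim: p => [|x a|a1 a2|p1 IH1 p2 IH2|a p1 IH1 p2 IH2|a p1 IH] /=;
  rewrite ?muln1 //; last 1 first.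
- rewrite mul1n expnS; have := pos (loop_depth p1); nia.
- rewrite mulnDl leq_add //.
    exact: up (leq_maxl _ _) IH1.
  exact: up (leq_maxr _ _) IH2.
- have := up _ _ _ _ (leq_maxl _ (loop_depth p2)) IH1.
  have := up _ _ _ _ (leq_maxr (loop_depth p1) _) IH2.
  have := pos (maxn (loop_depth p1) (loop_depth p2)).
  move: (_ ^ maxn _ _) => X X0 le2 le1.
  rewrite maxnE; case: (leqP (cost_bound 1 p1) (cost_bound 1 p2)) => ?; nia.
Qed.

Section Machine.

Variables S W N : nat.

(** Total correctness with a time bound built in, so that one derivation yields termination, running
    time and the postcondition. *)
Definition runs (p : com) (s : state) (Q : state -> Prop) : Prop :=
  exists t s', [/\ t <= cost_bound N p, exec S W p s t s' & Q s'].

Lemma runs_conseq p s (Q Q' : state -> Prop) :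
  runs p s Q -> (forall s', Q s' -> Q' s') -> runs p s Q'.
Proof. by move=> [t [s' [tp ps q]]] QQ'; exists t, s'; split=> //; apply: QQ'. Qed.

Lemma runs_set x a s v (Q : state -> Prop) :
  eval S W s a = Some v -> Q (set_reg s x v) -> runs (Set_reg x a) s Q.
Proof. by move=> ea q; do 2!eexists; split; [|apply: ExecSet ea|]. Qed.

Lemma runs_write a1 a2 s i v (Q : state -> Prop) :
  eval S W s a1 = Some i -> i < S -> eval S W s a2 = Some v ->
  Q (set_mem s i v) -> runs (Write a1 a2) s Q.
Proof. by move=> e1 iS e2 q; do 2!eexists; split; [|apply: ExecWrite e1 iS e2|]. Qed.

Lemma runs_seq p1 p2 s (Q : state -> Prop) :
  runs p1 s (fun s1 => runs p2 s1 Q) -> runs (Seq p1 p2) s Q.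
Proof.
move=> [t1 [s1 [tp1 e1 [t2 [s2 [tp2 e2 q]]]]]].
by exists (t1 + t2), s2; split; [apply: leq_add|apply: ExecSeq e1 e2|].
Qed.

Lemma runs_if a p1 p2 s v (Q : state -> Prop) :
  eval S W s a = Some v ->
  (v != 0 -> runs p1 s Q) -> (v == 0 -> runs p2 s Q) -> runs (If a p1 p2) s Q.
Proof.
move=> ea r1 r2.
have [t [s' [tp es q]]] : exists t s',
    [/\ t <= maxn (cost_bound N p1) (cost_bound N p2),
        exec S W (if v != 0 then p1 else p2) s t s' & Q s'].
  have [v0|v0] := boolP (v == 0).
    have [t [s' [tp es q]]] := r2 v0; exists t, s'; split=> //.
    exact: leq_trans tp (leq_maxr _ _).
  have [t [s' [tp es q]]] := r1 v0; exists t, s'; split=> //.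
  exact: leq_trans tp (leq_maxl _ _).
exists (expr_cost a + t).+1, s'; split=> //; last exact: ExecIf ea es.
by rewrite /= ltnS leq_add2l.
Qed.

(** The invariant is indexed by the number of completed iterations; their exact count [m] gives the
    time bound through [m <= N]. *)
Lemma runs_while a p m (I : nat -> state -> Prop) s (Q : state -> Prop) :
  m <= N -> I 0 s ->
  (forall k s, k < m -> I k s ->
     exists v, [/\ eval S W s a = Some v, v != 0 & runs p s (I k.+1)]) ->
  (forall s, I m s -> eval S W s a = Some 0 /\ Q s) ->
  runs (While a p) s Q.
Proof.
move=> mN I0 step stop.
suff H d k s0 : k + d = m -> I k s0 ->
    exists t s', [/\ t <= d * (expr_cost a + cost_bound N p).+1 + (expr_cost a).+1,
      exec S W (While a p) s0 t s' & Q s'].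
  have [t [s' [tp es q]]] := H m 0 s (add0n m) I0; exists t, s'; split=> //.
  by apply: leq_trans tp _; rewrite /= leq_add2r leq_mul2r mN orbT.
elim: d k s0 => [|d IH] k s0.
  rewrite addn0 => -> /stop[ea q]; exists (expr_cost a).+1, s0.
  by split=> //; apply: ExecWhileStop.
move=> kd Ik; have km : k < m by lia.
have [v [ea v0 [t1 [s1 [tp1 e1 I1]]]]] := step _ _ km Ik.
have [|t2 [s2 [tp2 e2 q]]] := IH k.+1 s1 _ I1; first by lia.
exists (expr_cost a + t1 + t2).+1, s2; split=> //; last exact: ExecWhileStep ea v0 e1 e2.
by rewrite mulSn; move: tp1 tp2; lia.
Qed.

End Machine.

(** * The program *)

(* Beyond the [n + 1] input rows of length [n] the memory holds ten auxiliary
   rows: the visited flags of the vertices (0) and, indexed by positions in the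
   search order, the vertex (1), the position of the parent (2), the costs of the
   statuses 0, 1, 2 (3 to 5), the choices for a parent of status 0, 1, 2 (6 to 8)
   and the status finally chosen (9). *)
Definition cell (r a : expr) : expr :=
  Op Add (Op Mul (Reg 0) (Op Add (Op Add (Reg 0) (Const 1)) r)) a.

Definition aux (r a : expr) : expr := Read (cell r a).

(** The argument is a position of the search order; the vertex found there is the address of its
    color. *)
Definition color_at (a : expr) : expr := Read (aux (Const 1) a).

Definition adj_at (a1 a2 : expr) : expr :=
  Read (Op Add (Op Mul (Reg 0) (Op Add a1 (Const 1))) a2).

Definition incr (x : nat) : com := Set_reg x (Op Add (Reg x) (Const 1)).

Definition for_loop (x : nat) (p : com) : com :=
  While (Op Lt (Reg x) (Reg 0)) (Seq p (incr x)).

Definition compute_penalty : com :=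
  Seq (Set_reg 4 (Const 1)) (Seq (Set_reg 1 (Const 0))
    (for_loop 1 (Set_reg 4 (Op Add (Reg 4) (Read (Reg 1)))))).

(** Registers 1, 2 and 3 hold the position being scanned, the candidate neighbour and the number of
    vertices listed so far. *)
Definition visit : com :=
  If (Op Mul (adj_at (aux (Const 1) (Reg 1)) (Reg 2))
             (Op Eq (aux (Const 0) (Reg 2)) (Const 0)))
     (Seq (Write (cell (Const 0) (Reg 2)) (Const 1))
     (Seq (Write (cell (Const 1) (Reg 3)) (Reg 2))
     (Seq (Write (cell (Const 2) (Reg 3)) (Reg 1))
          (incr 3))))
     Skip.

(** Row 1 doubles as the queue of the search, with its head in register 1 and its end in register 3;
    the root is vertex 0. *)
Definition search : com :=
  Seq (Write (cell (Const 0) (Const 0)) (Const 1))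
  (Seq (Write (cell (Const 1) (Const 0)) (Const 0))
  (Seq (Set_reg 3 (Const 1))
  (Seq (Set_reg 1 (Const 0))
       (for_loop 1 (Seq (Set_reg 2 (Const 0)) (for_loop 2 visit)))))).

Definition init_costs : com :=
  Seq (Set_reg 1 (Const 0))
    (for_loop 1
      (Seq (Write (cell (Const 3) (Reg 1)) (Reg 4))
      (Seq (Write (cell (Const 4) (Reg 1)) (Const 0))
           (Write (cell (Const 5) (Reg 1))
              (Op Add (color_at (Reg 1))
                 (Op Mul (Op Eq (color_at (Reg 1)) (Const 0)) (Reg 4))))))).

(* Registers 1 and 5 hold a position and its parent, and registers 6 and 7 tell
   which of them has the larger color. The minimum of [a] and [b] is
   [a - (a - b)]. *)
Definition eliminate_status (r : nat) : com :=
  Seq (Set_reg 8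
        (Op Add (aux (Const 5) (Reg 1))
           (aux (if r == 0 then Op Add (Const 3) (Reg 6) else Const (3 + r))
              (Reg 5))))
  (Seq (Set_reg 9
        (Op Add
           (aux (if r == 2 then Op Add (Const 3) (Reg 7) else Const 3) (Reg 1))
           (aux (Const (3 + r)) (Reg 5))))
  (Seq (Write (cell (Const (6 + r)) (Reg 1)) (Op Lt (Reg 8) (Reg 9)))
       (Write (cell (Const (3 + r)) (Reg 5))
          (Op Defs.Sub (Reg 8) (Op Defs.Sub (Reg 8) (Reg 9)))))).

Definition load_parent : com :=
  Seq (Set_reg 5 (aux (Const 2) (Reg 1)))
  (Seq (Set_reg 6 (Op Lt (color_at (Reg 5)) (color_at (Reg 1))))
       (Set_reg 7 (Op Lt (color_at (Reg 1)) (color_at (Reg 5))))).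

(** The statuses are treated in increasing order because the costs are updated in place: status 0
    may read the parent's entry for status 1, which must still be the old one. *)
Definition bottom_up : com :=
  Seq (Set_reg 1 (Reg 0))
    (While (Op Lt (Const 1) (Reg 1))
      (Seq (Set_reg 1 (Op Defs.Sub (Reg 1) (Const 1)))
      (Seq load_parent
      (Seq (eliminate_status 0)
      (Seq (eliminate_status 1) (eliminate_status 2)))))).

(** Besides fixing the status of the current position, each round corrects that of the parent, which
    the choice may turn from undominated to dominated. *)
Definition top_down : com :=
  Seq (Write (cell (Const 9) (Const 0))
        (Op Mul (Const 2)
           (Op Lt (aux (Const 5) (Const 0)) (aux (Const 3) (Const 0)))))
  (Seq (Set_reg 1 (Const 1))
    (for_loop 1
      (Seq load_parent
      (Seq (Set_reg 8 (aux (Const 9) (Reg 5)))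
      (Seq (Set_reg 9 (aux (Op Add (Const 6) (Reg 8)) (Reg 1)))
      (Seq (Write (cell (Const 9) (Reg 1))
             (Op Add (Op Mul (Const 2) (Reg 9))
                (Op Mul (Op Defs.Sub (Const 1) (Reg 9))
                   (Op Mul (Op Eq (Reg 8) (Const 2)) (Reg 7)))))
           (Write (cell (Const 9) (Reg 5))
             (Op Add (Reg 8)
                (Op Mul (Reg 9) (Op Mul (Op Eq (Reg 8) (Const 0)) (Reg 6))))))))))).

(** The result overwrites the colors, at the address given by the vertex rather than by its
    position. *)
Definition write_output : com :=
  Seq (Set_reg 1 (Const 0))
    (for_loop 1
      (Write (aux (Const 1) (Reg 1)) (Op Eq (aux (Const 9) (Reg 1)) (Const 2)))).

Definition domination_program : com :=
  Seq compute_penalty (Seq search (Seq init_costs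
    (Seq bottom_up (Seq top_down write_output)))).

(** * Correctness of the program *)

Definition upd (g : nat -> nat -> nat) (r i v : nat) : nat -> nat -> nat :=
  fun r' i' => if (r' == r) && (i' == i) then v else g r' i'.

Section Correctness.

Variables (n W : nat) (adj : nat -> nat -> bool).
Hypothesis n_gt0 : 0 < n.
Hypothesis W_large : n * (n + 11) + 20 < W.

Notation S := (n * (n + 11)).
Notation ev := (eval S W).
Notation run := (runs S W n).

(* [cf] is the contents of the output row and [g] that of the auxiliary rows. *)
Record rep (s : state) (cf : nat -> nat) (g : nat -> nat -> nat) : Prop := Rep {
  rep_n : regs s 0 = n;
  rep_reg : forall x, regs s x < W;
  rep_mem : forall a, Defs.mem s a < W;
  rep_row0 : forall i, i < n -> Defs.mem s i = cf i;
  rep_adj : forall u v, u < n -> v < n -> Defs.mem s (n * u.+1 + v) = adj u v;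
  rep_aux : forall r i, r < 10 -> i < n -> Defs.mem s (n * (n + 1 + r) + i) = g r i }.

(** * Evaluation of expressions in represented states *)

Lemma ev_lt_W s a v : ev s a = Some v -> v < W.
Proof.
have wordP m k : word W m = Some k -> k < W.
  by rewrite /word; case: ifP => // H [<-].
case: a => [k|x|a|o a1 a2] /=; try exact: wordP.
  by case: (ev s a) => // i; case: ifP => // _; apply: wordP.
by case: (ev s a1) => // i; case: (ev s a2) => // j; apply: wordP.
Qed.

Lemma ev_const s k : k < W -> ev s (Const k) = Some k.
Proof. by move=> kW; rewrite /= /word kW. Qed.

Lemma ev_reg s cf g x : rep s cf g -> ev s (Reg x) = Some (regs s x).
Proof. by move=> H; rewrite /= /word (rep_reg H). Qed.

Lemma ev_op s o a1 a2 v1 v2 : ev s a1 = Some v1 -> ev s a2 = Some v2 ->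
  apply_op o v1 v2 < W -> ev s (Op o a1 a2) = Some (apply_op o v1 v2).
Proof. by move=> /= -> -> vW; rewrite /word vW. Qed.

Lemma ev_sub s a1 a2 v1 v2 : ev s a1 = Some v1 -> ev s a2 = Some v2 ->
  ev s (Op Defs.Sub a1 a2) = Some (v1 - v2).
Proof.
move=> e1 e2; apply: (ev_op e1 e2).
exact: leq_ltn_trans (leq_subr _ _) (ev_lt_W e1).
Qed.

Lemma ev_lt s a1 a2 v1 v2 : ev s a1 = Some v1 -> ev s a2 = Some v2 ->
  ev s (Op Lt a1 a2) = Some (v1 < v2 : nat).
Proof. by move=> e1 e2; apply: (ev_op e1 e2); rewrite /=; lia. Qed.

Lemma ev_eq s a1 a2 v1 v2 : ev s a1 = Some v1 -> ev s a2 = Some v2 ->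
  ev s (Op Eq a1 a2) = Some (v1 == v2 : nat).
Proof. by move=> e1 e2; apply: (ev_op e1 e2); rewrite /=; lia. Qed.

Lemma ev_read s cf g a i : rep s cf g -> ev s a = Some i -> i < S ->
  ev s (Read a) = Some (Defs.mem s i).
Proof. by move=> H /= -> ->; rewrite /word (rep_mem H). Qed.

Lemma cell_lt r i : r < 10 -> i < n -> n * (n + 1 + r) + i < S.
Proof. by move=> r10 ilt; nia. Qed.

Lemma ev_cell s cf g a1 a2 r i : rep s cf g ->
  ev s a1 = Some r -> ev s a2 = Some i -> r < 10 -> i < n ->
  ev s (cell a1 a2) = Some (n * (n + 1 + r) + i).
Proof.
move=> H e1 e2 r10 ilt; have lt := cell_lt r10 ilt.
have [w0 w1 w2 w3] : [/\ n < W, 1 < W, n + 1 < W & n + 1 + r < W] by split; nia.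
have w4 : n * (n + 1 + r) < W by lia.
by rewrite /= e1 e2 /word (rep_n H) w0 w1 w2 w3 w4 ifT //; lia.
Qed.

Lemma ev_aux s cf g a1 a2 r i : rep s cf g ->
  ev s a1 = Some r -> ev s a2 = Some i -> r < 10 -> i < n ->
  ev s (aux a1 a2) = Some (g r i).
Proof.
move=> H e1 e2 r10 ilt; rewrite -(rep_aux H) //.
exact: ev_read H (ev_cell H e1 e2 r10 ilt) (cell_lt r10 ilt).
Qed.

Lemma ev_row0 s cf g a i : rep s cf g -> ev s a = Some i -> i < n ->
  ev s (Read a) = Some (cf i).
Proof. by move=> H ea ilt; rewrite -(rep_row0 H) //; apply: ev_read H ea _; nia. Qed.

Lemma ev_color s cf g a i : rep s cf g -> ev s a = Some i -> i < n -> g 1 i < n ->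
  ev s (color_at a) = Some (cf (g 1 i)).
Proof.
move=> H ea ilt glt; apply: (ev_row0 H _ glt).
by apply: ev_aux H _ ea _ ilt => //; apply: ev_const; lia.
Qed.

Lemma ev_adj s cf g a1 a2 u v : rep s cf g ->
  ev s a1 = Some u -> ev s a2 = Some v -> u < n -> v < n ->
  ev s (adj_at a1 a2) = Some (adj u v : nat).
Proof.
move=> H e1 e2 un vn; rewrite -(rep_adj H) //.
have lt : n * u.+1 + v < S by nia.
have nS := leq_pmull (n + 11) n_gt0.
have [w0 w1 w2] : [/\ n < W, 1 < W & u + 1 < W] by split; lia.
have w3 : n * (u + 1) < W by lia.
apply: (ev_read H _ lt).
by rewrite /= e1 e2 /word (rep_n H) w0 w1 w2 w3 addn1 ifT //; lia.
Qed.

(** * Updates of represented states *)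

Lemma rep_set_reg s cf g x v : rep s cf g -> x != 0 -> v < W ->
  rep (set_reg s x v) cf g.
Proof.
move=> H x0 vW; split=> /=; [|move=> y| | | |]; try by case: H.
  by rewrite eq_sym (negbTE x0) (rep_n H).
by case: eqP => // _; apply: rep_reg H y.
Qed.

(** Uniqueness of quotient and remainder modulo [n]: distinct entries never share a cell. *)
Lemma cell_inj r i r' i' : i < n -> i' < n ->
  (n * r + i == n * r' + i') = (r == r') && (i == i').
Proof.
move=> ilt i'lt; apply/eqP/andP => [E|[/eqP-> /eqP->] //].
have Er : r = r'.
  have := congr1 (divn^~ n) E.
  by rewrite ![n * _]mulnC !divnMDl // !divn_small // !addn0.
by rewrite {}Er in E *; rewrite eqxx; split=> //; apply/eqP; apply: addnI E.
Qed.

Lemma rep_write s cf g r i v : rep s cf g -> r < 10 -> i < n -> v < W ->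
  rep (set_mem s (n * (n + 1 + r) + i) v) cf (upd g r i v).
Proof.
move=> H r10 ilt vW; have := cell_inj (n + 1 + r); split; try by case: H.
- by move=> a /=; case: eqP => // _; apply: rep_mem H a.
- move=> j jn /=; rewrite ifN; first exact: rep_row0 H j jn.
  by rewrite neq_ltn; apply/orP; left; nia.
- move=> u w un wn /=; rewrite cell_inj // ifN; first exact: rep_adj H u w un wn.
  by lia.
- move=> r' i' r'10 i'n /=; rewrite cell_inj // !eqn_add2l /upd.
  by case: ifP => // _; apply: rep_aux H _ _ _ _.
Qed.

Lemma rep_write0 s cf g i v : rep s cf g -> i < n -> v < W ->
  rep (set_mem s i v) [eta cf with i |-> v] g.
Proof.
move=> H ilt vW; split; try by case: H.
- by move=> a /=; case: eqP => // _; apply: rep_mem H a.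
- by move=> j jn /=; case: eqP => // _; apply: rep_row0 H j jn.
- move=> u w un wn /=; rewrite ifN; first exact: rep_adj H u w un wn.
  by rewrite neq_ltn; apply/orP; right; nia.
- move=> r' i' r'10 i'n /=; rewrite ifN; first exact: rep_aux H _ _ _ _.
  by rewrite neq_ltn; apply/orP; right; nia.
Qed.

Lemma run_set s cf g x a v v' (Q : state -> Prop) :
  rep s cf g -> x != 0 -> ev s a = Some v' -> v' = v ->
  (rep (set_reg s x v) cf g -> Q (set_reg s x v)) -> run (Set_reg x a) s Q.
Proof.
move=> H x0 ea <- q; apply: (runs_set _ ea); apply: q.
by apply: rep_set_reg => //; apply: ev_lt_W ea.
Qed.

Lemma run_write s cf g a1 a2 a3 r i r' i' v v' (Q : state -> Prop) :
  rep s cf g -> ev s a1 = Some r' -> ev s a2 = Some i' -> ev s a3 = Some v' ->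
  r' = r -> i' = i -> v' = v -> r < 10 -> i < n ->
  (rep (set_mem s (n * (n + 1 + r) + i) v) cf (upd g r i v) ->
   Q (set_mem s (n * (n + 1 + r) + i) v)) ->
  run (Write (cell a1 a2) a3) s Q.
Proof.
move=> H e1 e2 e3 Er Ei Ev r10 ilt q; rewrite Er Ei Ev in e1 e2 e3.
apply: (runs_write _ (ev_cell H e1 e2 r10 ilt) (cell_lt r10 ilt) e3).
by apply: q; apply: rep_write => //; apply: ev_lt_W e3.
Qed.

Lemma run_incr s cf g x (Q : state -> Prop) : rep s cf g -> x != 0 ->
  regs s x < n ->
  (rep (set_reg s x (regs s x).+1) cf g -> Q (set_reg s x (regs s x).+1)) ->
  run (incr x) s Q.
Proof.
move=> H x0 xn q; have cW : 1 < W by lia.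
apply: (run_set H x0 (ev_op (o := Add) (ev_reg x H) (ev_const s cW) _) _ q).
  by rewrite /=; lia.
by rewrite /= addn1.
Qed.

(** The body need only preserve the counter; the rule performs the increment and supplies [rep] for
    the resulting state. *)
Lemma run_for x p a (I : nat -> state -> Prop) s (Q : state -> Prop) :
  x != 0 -> a <= n -> I a s ->
  (forall k s, I k s -> regs s x = k /\ exists cf g, rep s cf g) ->
  (forall k s, a <= k < n -> I k s -> run p s (fun s1 =>
     regs s1 x = k /\ exists cf g,
       rep s1 cf g /\ (rep (set_reg s1 x k.+1) cf g -> I k.+1 (set_reg s1 x k.+1)))) ->
  (forall s, I n s -> Q s) ->
  run (for_loop x p) s Q.
Proof.
move=> x0 an Ia Irep step stop.
apply: (@runs_while _ _ _ _ _ (n - a) (fun k => I (a + k))).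
- exact: leq_subr.
- by rewrite addn0.
- move=> k s0 kn Ik; have [xk [cf [g H]]] := Irep _ _ Ik.
  exists 1; split=> //.
    by rewrite (ev_lt (ev_reg x H) (ev_reg 0 H)) xk (rep_n H); congr Some; lia.
  apply: runs_seq; apply: runs_conseq (step _ _ _ Ik) _; first by lia.
  move=> s1 [xk1 [cf1 [g1 [H1 q]]]].
  by apply: (run_incr H1 x0); rewrite xk1; [lia|rewrite addnS].
- move=> s0; rewrite subnKC // => In; split; last exact: stop.
  have [xk [cf [g H]]] := Irep _ _ In.
  by rewrite (ev_lt (ev_reg x H) (ev_reg 0 H)) xk (rep_n H) ltnn.
Qed.

Ltac norm_regs :=
  rewrite /upd /=; repeat match goal with
    [ H : regs ?s ?x = _ |- context [regs ?s ?x] ] => rewrite H end.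

Ltac side := norm_regs; first [assumption | done | lia |
    repeat match goal with |- context [nat_of_bool ?b] => case: b end;
    rewrite /=; lia].

(** Subtraction and the tests have their own cases since their values are always words; the other
    operations leave a bound to [side]. *)
Ltac ev :=
  lazymatch goal with
  | |- eval _ _ _ (Const _) = _ => apply: ev_const; lia
  | |- eval _ _ _ (Reg _) = _ => eapply ev_reg; eassumption
  | |- eval _ _ _ (Op Defs.Sub _ _) = _ => eapply ev_sub; ev
  | |- eval _ _ _ (Op Lt _ _) = _ => eapply ev_lt; ev
  | |- eval _ _ _ (Op Eq _ _) = _ => eapply ev_eq; ev
  | |- eval _ _ _ (Op _ _ _) = _ => eapply ev_op; [ev | ev | side]
  | |- eval _ _ _ (aux _ _) = _ => eapply ev_aux; [eassumption | ev | ev | side | side]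
  | |- eval _ _ _ (color_at _) = _ => eapply ev_color; [eassumption | ev | side | side]
  | |- eval _ _ _ (adj_at _ _) = _ => eapply ev_adj; [eassumption | ev | ev | side | side]
  | |- eval _ _ _ (Read _) = _ => eapply ev_row0; [eassumption | ev | side]
  end.

Lemma compute_penalty_correct s c g (Q : state -> Prop) :
  rep s c g -> (\sum_(j < n) c j).+1 < W ->
  (forall s', rep s' c g -> regs s' 4 = (\sum_(j < n) c j).+1 -> Q s') ->
  run compute_penalty s Q.
Proof.
move=> H sW q.
apply: runs_seq; apply: (run_set H); [by [] | ev | by [] | move=> H1].
apply: runs_seq; apply: (run_set H1); [by [] | ev | by [] | move=> H2].
apply: (@run_for 1 _ 0 (fun k s => [/\ rep s c g, regs s 1 = k &
          regs s 4 = (\sum_(j < k) c j).+1])) => //.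
- by split=> //=; rewrite big_ord0.
- by move=> k s0 [H0 R1 _]; split=> //; exists c, g.
- move=> k s0 /andP[_ kn] [H0 R1 R4].
  (* Partial sums never exceed the final one, which is a word. *)
  have le : \sum_(j < k.+1) c j <= \sum_(j < n) c j.
    rewrite -!(big_mkord xpredT c) [X in _ <= X](big_cat_nat (n := k.+1)) //=.
    exact: leq_addr.
  rewrite big_ord_recr /= in le.
  have lt : (\sum_(j < k) c j).+1 + c k < W.
    by apply: leq_ltn_trans sW; rewrite addSn ltnS.
  apply: (run_set H0); [by [] | ev | reflexivity | move=> H3].
  split; first by norm_regs.
  exists c, g; split=> // H4; split=> //; norm_regs => //.
  by rewrite big_ord_recr /=.
- by move=> s0 [H0 _ R4]; apply: q.
Qed.

(** * Breadth-first search of the tree *)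

Variables (o : nat -> 'I_n) (e : rel 'I_n).
Hypothesis oK : forall u, u < n -> o u = u :> nat.
Hypothesis adjE : forall u v, u < n -> v < n -> adj u v = e (o u) (o v).
Hypothesis tree : is_tree e.

(** Invariant of the search: [m] vertices are listed, the neighbours of the positions below [i] are
    all flagged, and so are those of position [i] numbered below [v]. *)
Record searching (g : nat -> nat -> nat) (m i v : nat) : Prop := Searching {
  searching_order : search_order e (fun j => o (g 1 j)) (g 2) m;
  searching_gt0 : 0 < m;
  searching_lt : forall j, j < m -> g 1 j < n;
  searching_flag : forall w, w < n ->
    g 0 w = has (fun j => g 1 j == w) (iota 0 m);
  searching_done : forall j w, j < i -> w < n -> adj (g 1 j) w -> g 0 w != 0;
  searching_row : forall w, w < v -> adj (g 1 i) w -> g 0 w != 0 }.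

Lemma searching_flagP g m i v w : searching g m i v -> w < n ->
  reflect (exists2 j, j < m & g 1 j = w) (g 0 w != 0).
Proof.
move=> B wn; rewrite (searching_flag B wn) eqb0 negbK.
apply: (iffP hasP) => [[j]|[j jm <-]].
  by rewrite mem_iota => /andP[_ jm] /eqP; exists j.
by exists j; rewrite // mem_iota.
Qed.

Lemma searching_step g m i v : searching g m i v -> i < m -> v < n ->
  adj (g 1 i) v -> g 0 v = 0 ->
  m < n /\ searching (upd (upd (upd g 0 v 1) 1 m v) 2 m i) m.+1 i v.+1.
Proof.
move=> B im vn av gv; set g' := upd _ _ _ _.
have new j : j < m -> g 1 j != v.
  move=> jm; apply: contra_eqN gv => /eqP E.
  by apply/(searching_flagP B vn); exists j.
have g1 j : g' 1 j = if j == m then v else g 1 j by [].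
have g2 j : g' 2 j = if j == m then i else g 2 j by [].
have g0 w : g' 0 w = if w == v then 1 else g 0 w by [].
have ltm j : j < m -> (j == m) = false by lia.
have so' : search_order e (fun j => o (g' 1 j)) (g' 2) m.+1.
  apply: (@search_orderS _ _ tree _ _ _ i).
  - apply: (search_order_ext (searching_order B)) => j jm.
      by rewrite g1 ltm.
    by rewrite g2 ltm.
  - by [].
  - by rewrite g2 eqxx.
  - by rewrite !g1 eqxx ltm // -adjE // (searching_lt B).
  - move=> j jm; rewrite !g1 eqxx ltm //; apply: contra (new _ jm) => /eqP E.
    by rewrite -(oK (searching_lt B jm)) E oK.
(* An order of [m.+1] distinct vertices forces [m < n], which keeps the writes at index [m] inside
   their rows. *)
split; first by rewrite -[n in _ < n]card_ord; apply: search_order_size so'.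
split=> //.
- move=> j jm; rewrite g1; case: eqP => // jNm.
  by apply: (searching_lt B); lia.
- move=> w wn; rewrite g0 -[m.+1]addn1 iotaD has_cat /= orbF add0n g1 eqxx.
  rewrite eq_sym; case: eqP => [_|_]; first by rewrite orbT.
  rewrite orbF (searching_flag B wn); congr nat_of_bool.
  by apply: eq_in_has => j; rewrite mem_iota add0n => /andP[_ jm]; rewrite g1 ltm.
- move=> j w ji wn; rewrite g0 g1 ltm; last by lia.
  by case: (w =P v) => // _; exact: (searching_done B ji wn).
- move=> w wv; rewrite g0 g1 ltm //; case: (w =P v) => // wNv.
  have wv' : w < v by lia.
  exact: (searching_row B wv').
Qed.

Lemma searching_skip g m i v : searching g m i v ->
  (adj (g 1 i) v -> g 0 v != 0) -> searching g m i v.+1.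
Proof.
case=> so m0 lt fl dn row av; split=> // w.
by rewrite ltnS leq_eqVlt => /predU1P[->|/row].
Qed.

Lemma searching_next g m i : searching g m i n -> searching g m i.+1 0.
Proof.
case=> so m0 lt fl dn row; split=> // j w.
by rewrite ltnS leq_eqVlt => /predU1P[->|ji]; [exact: row | exact: dn].
Qed.

(** Once every listed position has been scanned, the list is closed under neighbours. *)
Lemma searching_full g m v : searching g m m v -> m = n.
Proof.
move=> B; rewrite -[RHS]card_ord.
apply: (search_order_full tree (searching_order B) (searching_gt0 B)).
move=> j jm w ew; have wn := ltn_ord w.
have ow : o w = w by apply: val_inj; rewrite /= oK.
have : g 0 w != 0.
  by apply: (searching_done B jm wn); rewrite adjE ?(searching_lt B) // ow.
by move/(searching_flagP B wn) => [k km Ek]; exists k; rewrite // Ek ow.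
Qed.

(** Connectedness keeps the queue nonempty until all vertices have been scanned, which is why the
    loop can simply run up to [n]. *)
Lemma searching_lt_full g m i : searching g m i 0 -> i <= m -> i < n -> i < m.
Proof.
move=> B im lt_in; rewrite ltn_neqAle im andbT; apply/eqP => Ei.
by rewrite Ei in B lt_in; rewrite (searching_full B) ltnn in lt_in.
Qed.

Lemma visit_correct s c g m i v M (Q : state -> Prop) :
  rep s c g -> searching g m i v -> i < m -> v < n ->
  regs s 1 = i -> regs s 2 = v -> regs s 3 = m -> regs s 4 = M ->
  (forall s' g' m', rep s' c g' -> searching g' m' i v.+1 -> i < m' ->
     regs s' 1 = i -> regs s' 2 = v -> regs s' 3 = m' -> regs s' 4 = M -> Q s') ->
  run visit s Q.
Proof.
move=> H B im vn R1 R2 R3 R4 q.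
have giv : g 1 i < n by apply: (searching_lt B).
have mn : m <= n by rewrite -[n]card_ord; apply: search_order_size (searching_order B).
have lt_in : i < n := leq_trans im mn.
have b1 (b1 b2 : bool) : b1 * b2 < W by lia.
eapply runs_if.
- eapply ev_op; [ev | ev | norm_regs; exact: b1].
- norm_regs; rewrite muln_eq0 negb_or !eqb0 !negbK => /andP[av /eqP gv].
  have [mlt B'] := searching_step B im vn av gv.
  apply: runs_seq.
  apply: (@run_write _ _ _ _ _ _ 0 v _ _ 1 _ _ H); [ev|ev|ev|by []|by norm_regs|by []|by []|by []|].
  move=> H1; apply: runs_seq.
  apply: (@run_write _ _ _ _ _ _ 1 m _ _ v _ _ H1); [ev|ev|ev|by []|by norm_regs|by norm_regs|by []|by []|].
  move=> H2; apply: runs_seq.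
  apply: (@run_write _ _ _ _ _ _ 2 m _ _ i _ _ H2); [ev|ev|ev|by []|by norm_regs|by norm_regs|by []|by []|].
  move=> H3; apply: (run_incr H3) => //=; first by rewrite R3.
  rewrite R3 => H4; apply: (q _ _ m.+1 H4 B') => //=; lia.
- norm_regs; rewrite muln_eq0 !eqb0 => av.
  exists 1, s; split=> //; first exact: ExecSkip.
  apply: (q _ _ m H) => //; apply: (searching_skip B) => a.
  by move: av; rewrite a.
Qed.

Lemma search_correct s c g M (Q : state -> Prop) :
  rep s c g -> (forall w, w < n -> g 0 w = 0) -> regs s 4 = M ->
  (forall s' g', rep s' c g' -> regs s' 4 = M ->
     search_order e (fun j => o (g' 1 j)) (g' 2) n ->
     (forall j, j < n -> g' 1 j < n) -> Q s') ->
  run search s Q.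
Proof.
move=> H g0 R4 q; apply: runs_seq.
apply: (@run_write _ _ _ _ _ _ 0 0 _ _ 1 _ _ H); [ev|ev|ev|by []|by []|by []|by []|by []|].
move=> H1; apply: runs_seq.
apply: (@run_write _ _ _ _ _ _ 1 0 _ _ 0 _ _ H1); [ev|ev|ev|by []|by []|by []|by []|by []|].
move=> H2; apply: runs_seq; apply: (run_set H2); [by [] | ev | by [] | move=> H3].
apply: runs_seq; apply: (run_set H3); [by [] | ev | by [] | move=> H4].
apply: (@run_for 1 _ 0 (fun k s => exists g m, [/\ rep s c g, regs s 1 = k,
    regs s 3 = m, regs s 4 = M & searching g m k 0 /\ k <= m])) => //.
- exists (upd (upd g 0 0 1) 1 0 0), 1; split=> //; split=> //; split=> //.
  (* With a single listed vertex the conditions on parents are vacuous. *)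
  + by split=> [j k|j|j|j k]; lia.
  + move=> j; rewrite ltnS leqn0 => /eqP ->; by rewrite /upd /=.
  + by move=> w wn; rewrite /upd /= orbF eq_sym; case: eqP => //= _; apply: g0.
- by move=> k s0 [g1 [m [H0 R1]]]; split=> //; exists c, g1.
- move=> k s0 /andP[_ kn] [g1 [m [H0 R1 R3 R4' [B km]]]].
  have {}km := searching_lt_full B km kn.
  apply: runs_seq; apply: (run_set H0); [by [] | ev | by [] | move=> H5].
  apply: (@run_for 2 _ 0 (fun v s => exists g m, [/\ rep s c g, regs s 1 = k,
    regs s 2 = v, regs s 3 = m & [/\ regs s 4 = M, searching g m k v & k < m]])) => //.
  + by exists g1, m; split.
  + by move=> v s1 [g2 [m2 [H6 _ R2]]]; split=> //; exists c, g2.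
  + move=> v s1 /andP[_ vn] [g2 [m2 [H6 R1' R2 R3' [R4'' B2 km2]]]].
    apply: (visit_correct H6 B2 km2 vn R1' R2 R3' R4'') => s2 g3 m3 H7 B3 km3 S1 S2 S3 S4.
    split=> //; exists c, g3; split=> // H8.
    by exists g3, m3; split=> //; norm_regs.
  + move=> s1 [g2 [m2 [H6 R1' R2 R3' [R4'' B2 km2]]]].
    split=> //; exists c, g2; split=> // H7.
    exists g2, m2; split=> //; norm_regs => //; split; last by [].
    exact: searching_next.
- move=> s0 [g1 [m [H0 R1 R3 R4' [B nm]]]].
  have mn : m = n.
    apply/eqP; rewrite eqn_leq nm andbT -[X in _ <= X]card_ord.
    exact: search_order_size (searching_order B).
  rewrite mn in B; apply: (q _ _ H0 R4' (searching_order B)).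
  exact: searching_lt B.
Qed.

(** * The dynamic program in memory *)

Variables c ordn q : nat -> nat.
Hypothesis ordn_lt : forall j, j < n -> ordn j < n.

(** The search order stays fixed from here on; among the auxiliary rows only 3 to 9 still change. *)
Definition laid_out (g : nat -> nat -> nat) : Prop :=
  forall j, j < n -> g 1 j = ordn j /\ g 2 j = q j.

Lemma write_output_correct s g x (Q : state -> Prop) :
  (forall j k, j < n -> k < n -> ordn j = ordn k -> j = k) ->
  rep s c g -> laid_out g -> (forall j, j < n -> (g 9 j == 2) = x j) ->
  (forall s', (forall j, j < n -> (Defs.mem s' (ordn j) != 0) = x j) -> Q s') ->
  run write_output s Q.
Proof.
move=> ordn_inj H L gx qq; apply: runs_seq.
apply: (run_set (v := 0) H); [by []|ev|by []|move=> H1].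
apply: (@run_for 1 _ 0 (fun i s => exists cf, [/\ rep s cf g, regs s 1 = i &
    forall j, j < i -> (cf (ordn j) != 0) = x j])) => //.
- by exists c.
- by move=> k s0 [cf [H0 R1 _]]; split=> //; exists cf, g.
- move=> i s0 /andP[_ lt_in] [cf [H0 R1 I]].
  have [g1i _] := L _ lt_in; have oi := ordn_lt lt_in.
  apply: (@runs_write _ _ _ _ _ _ (ordn i) (x i)).
  + by rewrite -g1i -R1; ev; rewrite R1.
  + by apply: leq_trans oi _; rewrite leq_pmulr // addnS.
  + by rewrite -gx // -R1; ev.
  have xW : x i < W by case: (x i); lia.
  have H2 := rep_write0 H0 oi xW.
  split; first by norm_regs.
  do 2!eexists; split; [exact: H2 | move=> H3].
  eexists; split; [exact: H3|by []|] => j; rewrite ltnS leq_eqVlt.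
  case/predU1P => [->|ji]; first by rewrite /= eqxx eqb0 negbK.
  rewrite /= ifN; first exact: I.
  (* Distinct positions carry distinct vertices, so earlier results survive the write. *)
  apply/eqP => /(ordn_inj _ _ (ltn_trans ji lt_in) lt_in) Eji.
  by rewrite Eji ltnn in ji.
- move=> s0 [cf [H0 _ I]]; apply: qq => j jn.
  by rewrite (rep_row0 H0) ?I // ordn_lt.
Qed.

Hypothesis q_lt : forall j, 0 < j < n -> q j < j.

Let col (j : nat) : nat := c (ordn j).

Variable M : nat.

(** The table [initial_cost] over vertex numbers; with [M] the penalty, the two are convertible in
    the final run. *)
Let K0 (r j : nat) : nat :=
  if r == 0 then M else if r == 1 then 0 else col j + (col j == 0) * M.

Hypothesis K0_W : \sum_(j < n) max3 K0 j < W.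

Lemma init_costs_correct s g (Q : state -> Prop) :
  rep s c g -> laid_out g -> regs s 4 = M ->
  (forall s' g', rep s' c g' -> laid_out g' ->
     (forall r j, r < 3 -> j < n -> g' (3 + r) j = K0 r j) -> Q s') ->
  run init_costs s Q.
Proof.
move=> H L R4 qq; apply: runs_seq; apply: (run_set H); [by [] | ev | by [] | move=> H1].
apply: (@run_for 1 _ 0 (fun k s => exists g, [/\ rep s c g, laid_out g, regs s 1 = k,
   regs s 4 = M & forall r j, r < 3 -> j < k -> g (3 + r) j = K0 r j])) => //.
- by exists g; split.
- by move=> k s0 [g0 [H0 _ R1 _ _]]; split=> //; exists c, g0.
- move=> k s0 /andP[_ kn] [g0 [H0 L0 R1 R4' I]].
  have [g1k g2k] := L0 _ kn; have okn := ordn_lt kn.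
  have g1lt : g0 1 k < n by rewrite g1k.
  have KW : K0 2 k < W.
    apply: leq_ltn_trans K0_W; rewrite (bigD1 (Ordinal kn)) //=.
    by rewrite (leq_trans (leq_max3 K0 k (s := 2) _)) // leq_addr.
  have K2 : c (g0 1 k) + (c (g0 1 k) == 0) * M = K0 2 k by rewrite g1k.
  rewrite -K2 in KW.
  apply: runs_seq.
  apply: (@run_write _ _ _ _ _ _ 3 k _ _ M _ _ H0); [ev|ev|ev|by []|by norm_regs|by norm_regs|by []|by []|].
  move=> H2; apply: runs_seq.
  apply: (@run_write _ _ _ _ _ _ 4 k _ _ 0 _ _ H2); [ev|ev|ev|by []|by norm_regs|by norm_regs|by []|by []|].
  move=> H3.
  apply: (@run_write _ _ _ _ _ _ 5 k _ _ (K0 2 k) _ _ H3); [ev|ev|ev|by []|by norm_regs|by norm_regs|by []|by []|].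
  move=> H4; split; first by norm_regs.
  do 2!eexists; split; [exact: H4 | move=> H5].
  eexists; split; [exact: H5| | |by norm_regs|].
  + by move=> j jn; rewrite /upd /=; apply: L0.
  + by [].
  + move=> r j r3; rewrite ltnS leq_eqVlt /upd => /predU1P[->|jk].
      by rewrite eqxx !andbT; case: r r3 => [|[|[|]]].
    have -> : (j == k) = false by lia.
    by rewrite !andbF; apply: I.
- by move=> s0 [g0 [H0 L0 _ _ I]]; apply: qq H0 L0 I.
Qed.

Lemma load_parent_correct s g u (Q : state -> Prop) :
  rep s c g -> laid_out g -> regs s 1 = u -> 0 < u < n ->
  (forall s', rep s' c g -> regs s' 1 = u -> regs s' 5 = q u ->
     regs s' 6 = (col (q u) < col u) -> regs s' 7 = (col u < col (q u)) -> Q s') ->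
  run load_parent s Q.
Proof.
move=> H L R1 un qq; have qu := q_lt un; case/andP: (un) => u0 ult.
have pn := ltn_trans qu ult.
have [g1u g2u] := L _ ult; have [g1p g2p] := L _ pn.
have g1u_lt : g 1 u < n by rewrite g1u ordn_lt.
have g1p_lt : g 1 (q u) < n by rewrite g1p ordn_lt.
apply: runs_seq.
apply: (run_set (v := q u) H); [by []|ev|by norm_regs|move=> H1].
apply: runs_seq.
apply: (run_set (v := (col (q u) < col u)) H1); [by []|ev|by norm_regs; rewrite g1u g1p|move=> H2].
apply: (run_set (v := (col u < col (q u))) H2); [by []|ev|by norm_regs; rewrite g1u g1p|move=> H3].
exact: qq.
Qed.

(** The parent's entries are assumed for the statuses from [r] on only, since those for smaller
    statuses have already been overwritten. *)
Lemma eliminate_status_correct s g K r u (Q : state -> Prop) :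
  r < 3 -> 0 < u < n -> rep s c g ->
  regs s 1 = u -> regs s 5 = q u ->
  regs s 6 = (col (q u) < col u) -> regs s 7 = (col u < col (q u)) ->
  (forall r', r' < 3 -> g (3 + r') u = K r' u) ->
  (forall r', r <= r' < 3 -> g (3 + r') (q u) = K r' (q u)) ->
  cost_in q col K r u < W -> cost_out q col K r u < W ->
  (forall s', rep s' c
       (upd (upd g (6 + r) u (choose_in q col K r u))
          (3 + r) (q u) (minn (cost_in q col K r u) (cost_out q col K r u))) ->
     (forall y, y < 8 -> regs s' y = regs s y) -> Q s') ->
  run (eliminate_status r) s Q.
Proof.
move=> r3 un H R1 R5 R6 R7 Ku Kp inW outW qq.
have qu := q_lt un; case/andP: (un) => u0 ult; have pn := ltn_trans qu ult.
set b1 := col (q u) < col u in R6; set b2 := col u < col (q u) in R7.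
have b1P : b1 <= 1 by exact: leq_b1.
have b2P : b2 <= 1 by exact: leq_b1.
have Ein : g 5 u + g (if r == 0 then 3 + b1 else 3 + r) (q u) = cost_in q col K r u.
  rewrite /cost_in -/b1 -(Ku 2) //; congr (_ + _).
  rewrite -Kp; last by case: r r3 {Kp inW outW qq} => [|[|[|]]] //; case: (b1).
  by case: (r =P 0) => [->|_]; rewrite /= ?mul1n ?addn0.
have Eout : g (if r == 2 then 3 + b2 else 3) u + g (3 + r) (q u) = cost_out q col K r u.
  rewrite /cost_out -/b2 -(Kp r); last by rewrite leqnn.
  rewrite -Ku; last by case: (r == 2); case: (b2).
  by case: (r == 2); rewrite ?mul1n ?mul0n ?addn0.
have row1 : (if r == 0 then 3 + b1 else 3 + r) < 10 by case: ifP; lia.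
have row2 : (if r == 2 then 3 + b2 else 3) < 10 by case: ifP; lia.
apply: runs_seq; apply: (run_set (v := cost_in q col K r u) H).
- by [].
- eapply ev_op.
  + ev.
  + eapply (@ev_aux _ _ _ _ _ (if r == 0 then 3 + b1 else 3 + r)); [eassumption| |ev|exact: row1|side].
    by case: ifP => _; rewrite -?R6; ev.
  + by norm_regs; rewrite Ein.
- by norm_regs.
move=> H1; apply: runs_seq; apply: (run_set (v := cost_out q col K r u) H1).
- by [].
- eapply ev_op.
  + eapply (@ev_aux _ _ _ _ _ (if r == 2 then 3 + b2 else 3)); [eassumption| |ev|exact: row2|side].
    case: ifP => _; last by ev.
    have <- : regs (set_reg s 8 (cost_in q col K r u)) 7 = b2 by rewrite /= R7.
    by ev.
  + ev.
  + by norm_regs; rewrite Eout.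
- by norm_regs.
move=> H2; apply: runs_seq.
apply: (@run_write _ _ _ _ _ _ (6 + r) u _ _ (choose_in q col K r u) _ _ H2); [ev|ev|ev|by []|by norm_regs|by norm_regs|by lia|by []|].
move=> H3.
apply: (@run_write _ _ _ _ _ _ (3 + r) (q u) _ _ (minn (cost_in q col K r u) (cost_out q col K r u)) _ _ H3); [ev|ev|ev|by []|by norm_regs|by norm_regs; rewrite minnE|by lia|by []|].
move=> H4; apply: qq H4 _ => y y8 /=.
by have [-> ->] : y == 9 = false /\ y == 8 = false by lia.
Qed.

Let st (d : nat) : nat -> nat -> nat := stage q col n K0 d.

Lemma bottom_up_correct s g (Q : state -> Prop) :
  rep s c g -> laid_out g ->
  (forall r j, r < 3 -> j < n -> g (3 + r) j = K0 r j) ->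
  (forall s' g', rep s' c g' -> laid_out g' ->
     (forall r, r < 3 -> g' (3 + r) 0 = st n.-1 r 0) ->
     (forall r j, r < 3 -> 0 < j < n ->
        g' (6 + r) j = choose_in q col (st (n - j.+1)) r j) -> Q s') ->
  run bottom_up s Q.
Proof.
move=> H L gK qq; apply: runs_seq.
apply: (run_set (v := n) H); [by []|ev|exact: rep_n H|move=> H1].
(* After [t] rounds rows 3 to 5 hold the costs of stage [t] below position [n - t], and rows 6 to 8
   the choices from that position on. *)
apply: (@runs_while _ _ _ _ _ n.-1 (fun t s => exists g, [/\ rep s c g, laid_out g,
    regs s 1 = n - t,
    (forall r j, r < 3 -> j < n - t -> g (3 + r) j = st t r j) &
    (forall r j, r < 3 -> n - t <= j < n ->
        g (6 + r) j = choose_in q col (st (n - j.+1)) r j)])).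
- exact: leq_pred.
- exists g; split=> //=; rewrite ?subn0 //.
  by move=> r j _; lia.
- move=> t s0 tn [g0 [H0 L0 R1 gst gch]]; exists 1; split=> //.
    rewrite (ev_lt (v1 := 1) (v2 := n - t)) //; last first.
    + by rewrite (ev_reg 1 H0) R1.
    + by ev.
    + by congr Some; lia.
  set u := n - t.+1; have un : 0 < u < n by lia.
  have uE : n - t = u.+1 by lia.
  have qu := q_lt un.
  apply: runs_seq; apply: (run_set (v := u) H0); [by []|ev|by norm_regs; lia|move=> H2].
  apply: runs_seq; apply: (load_parent_correct H2) => // s3 H3 S1 S5 S6 S7.
  (* No overflow: [u] and its parent are distinct positions still present at stage [t]. *)
  have pairW s1 s2 : s1 < 3 -> s2 < 3 -> st t s1 u + st t s2 (q u) < W.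
    move=> l1 l2; apply: leq_ltn_trans K0_W.
    by apply: stage_pair_le => //; lia.
  have inW r : r < 3 -> cost_in q col (st t) r u < W.
    move=> r3; apply: pairW => //.
    by case: r r3 => [|[|[|]]] //; case: (col (q u) < col u).
  have outW r : r < 3 -> cost_out q col (st t) r u < W.
    move=> r3; apply: pairW => //.
    by case: (r == 2); case: (col u < _).
  have row36 r r' : r < 3 -> (3 + r == 6 + r') = false by lia.
  have row63 r r' : r' < 3 -> (6 + r == 3 + r') = false by lia.
  have up : (u == q u) = false by lia.
  have pu : (q u == u) = false by lia.
  have Ku r : r < 3 -> g0 (3 + r) u = st t r u by move=> r3; apply: gst => //; lia.
  have Kp r : r < 3 -> g0 (3 + r) (q u) = st t r (q u).
    by move=> r3; apply: gst => //; lia.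
  apply: runs_seq; apply: (@eliminate_status_correct _ _ (st t) 0 _ _ _ un H3) => //.
  + exact: (inW 0 isT).
  + exact: (outW 0 isT).
  move=> s4 H4 E4.
  apply: runs_seq; apply: (@eliminate_status_correct _ _ (st t) 1 _ _ _ un H4);
    rewrite ?E4 //.
  + by move=> r r3; rewrite /upd up andbF row36 //; apply: Ku.
  + by case=> [|r] // r3; rewrite /upd pu andbF eqn_add2l /=; apply: Kp.
  + exact: (inW 1 isT).
  + exact: (outW 1 isT).
  move=> s5 H5 E5.
  apply: (@eliminate_status_correct _ _ (st t) 2 _ _ _ un H5); rewrite ?E5 ?E4 //.
  + by move=> r r3; rewrite /upd up !andbF !row36 //; apply: Ku.
  + by case=> [|[|r]] // r3; rewrite /upd pu !andbF !eqn_add2l /=; apply: Kp.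
  + exact: (inW 2 isT).
  + exact: (outW 2 isT).
  move=> s6 H6 E6; eexists; split; first exact: H6.
  + by move=> j jn; rewrite /upd /=; apply: L0.
  + by rewrite E6 // E5 // E4.
  + move=> r j r3 jm; rewrite /st /= -/u /eliminate -/(st t) /upd.
    have [->|jp] := eqVneq j (q u).
      by case: r r3 => [|[|[|]]] // _; rewrite /= ?eqxx ?pu.
    have ju : (j == u) = false by lia.
    by rewrite ju !andbF; apply: gst => //; lia.
  + move=> r j r3 jm; rewrite /upd.
    have [->|ju] := eqVneq j u.
      have -> : n - u.+1 = t by lia.
      by case: r r3 => [|[|[|]]] // _; rewrite /= ?eqxx ?up.
    rewrite (row63 r 0) // (row63 r 1) // (row63 r 2) // !andbF /=.
    by apply: gch => //; lia.
- move=> s0 [g0 [H0 L0 R1 gst gch]].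
  have n1 : n - n.-1 = 1 by lia.
  rewrite n1 in R1 gst gch; split.
    rewrite (ev_lt (v1 := 1) (v2 := 1)) //; first by ev.
    by rewrite (ev_reg 1 H0) R1.
  by apply: (qq _ _ H0 L0) => // r r3; apply: gst.
Qed.

(** The solution [x] is built along the loop; row 9 holds the statuses it induces on the positions
    visited so far. *)
Lemma top_down_correct s g (Q : state -> Prop) :
  rep s c g -> laid_out g ->
  (forall r, r < 3 -> g (3 + r) 0 = st n.-1 r 0) ->
  (forall r j, r < 3 -> 0 < j < n ->
     g (6 + r) j = choose_in q col (st (n - j.+1)) r j) ->
  (forall s' g' x, rep s' c g' -> laid_out g' -> optimal q col K0 n x ->
     (forall j, j < n -> (g' 9 j == 2) = x j) -> Q s') ->
  run top_down s Q.
Proof.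
move=> H L gst gch qq.
have k2 := gst 2 isT; have k0 := gst 0 isT.
apply: runs_seq.
apply: (@run_write _ _ _ _ _ _ 9 0 _ _ (2 * (st n.-1 2 0 < st n.-1 0 0)) _ _ H);
  [ev|ev|ev|by []|by []|by rewrite /= k2 k0|by []|by []|].
move=> H1; apply: runs_seq.
apply: (run_set (v := 1) H1); [by []|ev|by []|move=> H2].
apply: (@run_for 1 _ 1 (fun i s => exists g x, [/\ rep s c g, laid_out g, regs s 1 = i,
    (forall r j, r < 3 -> 0 < j < n ->
       g (6 + r) j = choose_in q col (st (n - j.+1)) r j) &
    [/\ x 0 = (st n.-1 2 0 < st n.-1 0 0),
        (forall j, 0 < j < i ->
           x j = choose_in q col (st (n - j.+1)) (status q col j x (q j)) j) &
        (forall j, j < i -> g 9 j = status q col i x j)]])) => //.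
(* Before the loop only [x 0] matters, so a constant function will do. *)
- eexists; exists (fun=> st n.-1 2 0 < st n.-1 0 0); split; [exact: H2| | | |].
  + by move=> j jn; rewrite /upd /=; apply: L.
  + by [].
  + move=> r j r3 jn; rewrite /upd.
    have -> : (6 + r == 9) = false by lia.
    exact: gch.
  + split=> // [j|j]; first by lia.
    rewrite ltnS leqn0 => /eqP->; rewrite /upd /= /status /dominated /= /adjp /=.
    by case: (_ < _).
- by move=> k s0 [g0 [x [H0 _ R1 _ _]]]; split=> //; exists c, g0.
- move=> i s0 ir [g0 [x [H0 L0 R1 gch0 [x0 xS gst9]]]].
  have qi := q_lt ir; case/andP: (ir) => i0 lt_in; have pn := ltn_trans qi lt_in.
  have [_ g2i] := L0 _ lt_in.
  apply: runs_seq; apply: (load_parent_correct H0 L0 R1 ir) => s1 H3 S1 S5 S6 S7.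
  pose sp := status q col i x (q i).
  have sp3 : sp < 3 := status_lt3 _ _ _ _ _.
  pose b := choose_in q col (st (n - i.+1)) sp i.
  have g9p : g0 9 (q i) = sp by apply: gst9.
  have gb : g0 (6 + sp) i = b by apply: gch0.
  apply: runs_seq; apply: (run_set (v := sp) H3); [by []|ev|by norm_regs|move=> H4].
  have row : 6 + sp < 10 by lia.
  apply: runs_seq; apply: (run_set (v := b) H4); [by []|ev|by norm_regs|move=> H5].
  (* [v1] and [v2] are the statuses of [i] and of its parent once position [i] is added, as given by
     [status_last] and [statusS_parent]. *)
  set v1 := 2 * b + (1 - b) * ((sp == 2) * (col i < col (q i))).
  set v2 := sp + b * ((sp == 0) * (col (q i) < col i)).
  apply: runs_seq.
  apply: (@run_write _ _ _ _ _ _ 9 i _ _ v1 _ _ H5);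
    [ev|ev|ev|by []|by norm_regs|by norm_regs|by []|by []|].
  move=> H6.
  apply: (@run_write _ _ _ _ _ _ 9 (q i) _ _ v2 _ _ H6);
    [ev|ev|ev|by []|by norm_regs|by norm_regs|by []|by []|].
  move=> H7; split; first by norm_regs.
  do 2!eexists; split; [exact: H7 | move=> H8].
  (* [x] is revised at [i] only, so statuses relative to the first [i] positions are unaffected. *)
  pose x' j := if j == i then b else x j.
  have ex j k : j <= i -> k < j -> x' k = x k.
    by move=> ji kj; rewrite /x' ifN //; lia.
  have est j k : j <= i -> k < j -> status q col j x' k = status q col j x k.
    by move=> ji kj; apply: eq_status => // l lj; apply: ex lj.
  have x'i : x' i = b by rewrite /x' eqxx.
  eexists; exists x'; split; [exact: H8| |by []| |split].
  + by move=> j jn; rewrite /upd /=; apply: L0.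
  + move=> r j r3 jn; rewrite /upd.
    have -> : (6 + r == 9) = false by lia.
    exact: gch0.
  + by rewrite (ex i).
  + move=> j /andP[j0]; rewrite ltnS leq_eqVlt => /predU1P[->|ji].
      by rewrite x'i est.
    have jr : 0 < j < n by lia.
    rewrite est ?(q_lt jr) // -?xS ?j0 //; last exact: ltnW.
    exact: (ex i).
  + move=> j; rewrite ltnS => ji; rewrite /upd /=.
    have [->|jq] := eqVneq j (q i).
      rewrite (statusS_parent _ q_lt) // est // x'i -/sp /v2.
      by rewrite -!mulnb.
    have [->|jNi] := eqVneq j i.
      rewrite (status_last _ q_lt) // x'i est // -/sp /v1.
      by case: (b); rewrite ?mul1n ?mul0n ?addn0.
    have lt_ji : j < i by lia.
    by rewrite (statusS_neq _ q_lt) // est // gst9.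
- move=> s0 [g0 [x [H0 L0 _ _ [x0 xS gst9]]]]; apply: (qq _ _ x H0 L0).
    exact: greedy_optimal.
  move=> j jn; rewrite gst9 // /status; case: (x j) => //.
  by case: dominated.
Qed.

End Correctness.

(** * Input layout, word size and the complete run *)

Lemma nth_allpairs (A B C : Type) (f : A -> B -> C) (s : seq A) (t : seq B)
    (a : A) (b : B) (d : C) (i j : nat) : i < size s -> j < size t ->
  nth d [seq f x y | x <- s, y <- t] (i * size t + j) = f (nth a s i) (nth b t j).
Proof.
move=> + jt; elim: s i => // x s IH [|i] /= si.
  by rewrite nth_cat size_map jt (nth_map b).
rewrite nth_cat size_map ifN; last by rewrite -leqNgt mulSn -addnA leq_addr.
by rewrite mulSn -addnA addKn IH.
Qed.

Section Run.

Variables (n : nat) (e : rel 'I_n) (c : 'I_n -> nat).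

Let W := word_bound 6 c.
Let b := n + (\max_(v < n) c v) + 2.

Lemma le_max_color v : c v <= \max_(v < n) c v.
Proof. exact: (leq_bigmax v). Qed.

Lemma penalty_le : penalty c <= b * b.
Proof.
have : \sum_v c v <= n * \max_(v < n) c v.
  rewrite -[X in X * _]card_ord -sum_nat_const.
  by apply: leq_sum => v _; apply: le_max_color.
by rewrite /penalty /b; nia.
Qed.

Hypothesis n_gt0 : 0 < n.

(** With [d = b * b] the exponent 6 gives [W = d ^ 3], whereas memory sizes are of order [d] and
    sums of costs are at most [d * d]; [d >= 9] leaves room for the constants. *)
Lemma word_bound_large :
  [/\ n * (n + 11) + 20 < W, n * penalty c < W, n < W & \max_(v < n) c v < W].
Proof.
have b3 : 2 < b by rewrite /b; lia.
have pen := penalty_le.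
have WE : W = (b * b) * (b * b) * (b * b).
  by rewrite /W /word_bound -/b !expnS expn0 muln1 !mulnA.
have nb : n < b by rewrite /b; lia.
have cb : \max_(v < n) c v < b by rewrite /b; lia.
have d9 : 3 * b <= b * b by nia.
set d := b * b in WE pen d9.
have nd : n * (n + 11) <= 4 * d by rewrite /d; nia.
have pd : n * penalty c <= d * d by nia.
have dd : 9 * d <= d * d by nia.
have ddd : 9 * (d * d) <= W by rewrite WE; nia.
by split; lia.
Qed.

Let x0 : 'I_n := Ordinal n_gt0.
Let o (u : nat) : 'I_n := insubd x0 u.

Lemma insubd_ordK u : u < n -> o u = u :> nat.
Proof. by move=> un; rewrite /o insubdK. Qed.

Lemma rep_input :
  rep n W (fun u v => e (o u) (o v)) (input e c) (fun u => c (o u)) (fun _ _ => 0).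
Proof.
have [W1 _ W2 W3] := word_bound_large.
have nthE u : u < n -> nth x0 (enum 'I_n) u = o u.
  by move=> un; apply: val_inj; rewrite /= nth_enum_ord // insubd_ordK.
split=> //=.
- by move=> x; case: ifP => // _; lia.
- move=> a; case: (ltnP a (size ([seq c v | v <- enum 'I_n] ++
      [seq nat_of_bool (e u v) | u <- enum 'I_n, v <- enum 'I_n]))) => [aS|aS].
    have := mem_nth 0 aS; rewrite mem_cat => /orP[/mapP[v _ ->]|/allpairsP[[u v] /= [_ _ ->]]].
      exact: leq_ltn_trans (le_max_color v) W3.
    by apply: leq_ltn_trans (leq_b1 _) _; lia.
  by rewrite nth_default //; lia.
- move=> i ilt; rewrite nth_cat size_map size_enum_ord ilt (nth_map x0) ?nthE //.
  by rewrite size_enum_ord.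
- move=> u v un vn; rewrite nth_cat size_map size_enum_ord ifN; last first.
    by rewrite -leqNgt mulnS -addnA leq_addr.
  have := @nth_allpairs _ _ _ (fun u v => nat_of_bool (e u v)) (enum 'I_n)
    (enum 'I_n) x0 x0 0 u v.
  by rewrite size_enum_ord !nthE // mulnS -addnA addKn mulnC => ->.
(* The auxiliary rows lie beyond the input list, where [nth] returns its default 0. *)
- move=> r i r10 ilt; rewrite nth_default // size_cat size_map size_allpairs.
  by rewrite size_enum_ord; nia.
Qed.

Lemma domination_program_run : is_tree e ->
  runs (n * (n + 11)) W n domination_program (input e c) (fun s =>
    (exists D, up_color_dominating e c D) -> omega_uc_dominating e c (output n s)).
Proof.
move=> tree; have [W1 W2 W3 W4] := word_bound_large.
have sumE : \sum_(j < n) c (o j) = \sum_v c v.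
  by apply: eq_bigr => j _; congr c; apply: val_inj; rewrite /= insubd_ordK.
apply: runs_seq.
apply: (compute_penalty_correct n_gt0 W1 rep_input).
  by rewrite sumE; apply: leq_ltn_trans W2; rewrite leq_pmull.
rewrite sumE -/(penalty c) => s1 H1 R1.
apply: runs_seq.
apply: (search_correct n_gt0 W1 insubd_ordK _ tree H1 _ R1) => // s2 g2 H2 R2 so lt.
have q_lt := parent_lt so.
set ord := (fun j => o (g2 1 j)) in so.
have KW : \sum_(j < n) max3 (initial_cost c ord) j < W.
  apply: leq_ltn_trans W2.
  rewrite -[X in X * _]card_ord -sum_nat_const.
  by apply: leq_sum => j _; apply: max3_initial_cost.
have L2 : laid_out n (g2 1) (g2 2) g2 by [].
apply: runs_seq; apply: (init_costs_correct n_gt0 W1 lt KW H2 L2 R2) => s3 g3 H3 L3 I3.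
apply: runs_seq; apply: (bottom_up_correct n_gt0 W1 lt q_lt KW H3 L3 I3).
move=> s4 g4 H4 L4 I4 C4.
apply: runs_seq; apply: (top_down_correct n_gt0 W1 lt q_lt KW H4 L4 I4 C4).
move=> s5 g5 x H5 L5 opt x5.
have inj j k : j < n -> k < n -> g2 1 j = g2 1 k -> j = k.
  by move=> jn kn E; apply: (ord_inj so) => //; rewrite /ord E.
apply: (write_output_correct n_gt0 W1 lt inj H5 L5 x5) => s6 out6.
apply: (optimal_omega_uc_dominating tree so _ _ opt); first exact: card_ord.
by move=> j jn; rewrite inE insubd_ordK ?lt // out6.
Qed.

End Run.

(** * Asymptotics *)

From mathcomp Require Import all_order all_algebra.
From mathcomp Require Import all_classical all_reals all_analysis.
Import numFieldNormedType.Exports.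
Import Order.TTheory GRing.Theory Num.Theory.

Local Open Scope classical_set_scope.
Local Open Scope ring_scope.

Lemma bigO_sqr (R : realType) (f : nat -> nat) (C : nat) :
  (forall n, (0 < n)%N -> (f n <= C * n ^ 2)%N) ->
  (fun n : nat => (f n)%:R : R) =O_\oo (fun n : nat => n%:R ^+ 2 : R).
Proof.
(* [C.+1] rather than [C] makes the constant positive. *)
move=> fC; apply/eqO_exP; exists C.+1%:R; first by rewrite ltr0n.
near=> n; rewrite ger0_norm ?ler0n // ger0_norm ?exprn_ge0 ?ler0n //.
rewrite -natrX -natrM ler_nat (leq_trans (fC n _)) ?leq_mul //.
by near: n; exists 1%N.
Unshelve. all: by end_near. Qed.

Lemma bigO_sqr_ln (R : realType) :
  (fun n : nat => n%:R ^+ 2 : R) =O_\oo (fun n : nat => n%:R ^+ 2 * ln n%:R : R).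
Proof.
have ln2_gt0 : 0 < ln 2%:R :> R by rewrite ln_gt0 // ltr1n.
(* From [n = 2] on, [ln n] is at least [ln 2]. *)
apply/eqO_exP; exists (ln 2%:R)^-1; first by rewrite invr_gt0.
near=> n; have n2 : (2 <= n)%N by near: n; exists 2%N.
have n2R : 2%:R <= n%:R :> R by rewrite ler_nat.
have ln2n : ln 2%:R <= ln n%:R :> R.
  by rewrite ler_ln // posrE ltr0n // (leq_trans _ n2).
rewrite !ger0_norm ?mulr_ge0 ?exprn_ge0 ?ler0n ?(le_trans (ltW ln2_gt0)) //.
rewrite mulrC -mulrA ler_peMr ?exprn_ge0 ?ler0n //.
by rewrite ler_pdivlMr // mul1r.
Unshelve. all: by end_near. Qed.

Theorem theorem7 (R : realType) :
  exists (p : com) (k : nat) (time space : nat -> nat),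
    [/\ (fun n : nat => (time n)%:R : R) =O_\oo
          (fun n : nat => n%:R ^+ 2 * ln n%:R : R),
        (fun n : nat => (space n)%:R : R) =O_\oo
          (fun n : nat => n%:R ^+ 2 : R) &
        forall (n : nat) (e : rel 'I_n) (c : 'I_n -> nat),
          is_tree e -> is_coloring e c ->
          exists (t : nat) (s : state),
            [/\ (t <= time n)%N,
                exec (space n) (word_bound k c) p (input e c) t s &
                (exists D : {set 'I_n}, up_color_dominating e c D) ->
                omega_uc_dominating e c (output n s)]].
Proof.
exists domination_program, 6%N, (cost_bound^~ domination_program),
  (fun n => n * (n + 11))%N; split.
(* The time bound is in fact quadratic; the logarithmic factor is slack. *)
- apply: eqO_trans (bigO_sqr_ln R).
  apply: (@bigO_sqr _ _ (cost_bound 1 domination_program)) => n n0.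
  (* [loop_depth domination_program] computes to 2, because of the nested loops of the search. *)
  exact: cost_bound_poly.
(* For [n > 0], [n * (n + 11)] is at most [(1 + 11) * n ^ 2]. *)
- apply: (@bigO_sqr _ _ 12) => n n0.
  by rewrite -mulnn mulnCA leq_mul2l mulSn leq_add2l leq_pmulr ?orbT.
- move=> n e c tree _; have n_gt0 : (0 < n)%N by case: (tree); rewrite card_ord.
  exact: domination_program_run.
Qed.
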